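(* Let $P=\mathbf P(\mathcal{TL}_n)$ be the projection algebra of a finite Temperley--Lieb monoid $\mathcal{TL}_n$. Then $\mathsf{PG}(P)\cong\mathcal{TL}_n$ (as semigroups).
   Context: Maps are written to the right of their arguments and composed left to right. TEMPERLEY--LIEB MONOIDS. Let $n\geq1$. The elements of the partition monoid $\mathcal P_n$ are the set partitions of $\{1,\ldots,n\}\cup\{1',\ldots,n'\}$, drawn with vertices $1,\ldots,n$ on an upper row and $1',\ldots,n'$ directly below on a lower row. The product $\alpha\beta$ is found by identifying each lower vertex $i'$ of $\alpha$ with the upper vertex $i$ of $\beta$ (giving a middle row), and letting $x,y\in\{1,\ldots,n\}\cup\{1',\ldots,n'\}$ (upper vertices of $\alpha$, lower vertices of $\beta$) belong to the same block of $\alpha\beta$ iff they are joined by a path in the resulting graph; components contained in the middle row are deleted. The involution $\alpha\mapsto\alpha^*$ interchanges $i$ and $i'$ for all $i$. The Temperley--Lieb monoid $\mathcal{TL}_n$ is the submonoid of all partitions whose blocks all have size $2$ and which can be drawn in planar fashion (without crossings) within the rectangle bounded by the vertices. It is a regular $*$-semigroup: $(\alpha^* )^*=\alpha=\alpha\alpha^*\alpha$ and $(\alpha\beta)^*=\beta^*\alpha^*$. PROJECTION ALGEBRAS. A projection algebra is a set $P$ with unary operations $\theta_p:P\to P$ ($p\in P$) such that for all $p,q\in P$: $p\theta_p=p$; $\theta_p\theta_p=\theta_p$; $p\theta_q\theta_p=q\theta_p$; $\theta_p\theta_q\theta_p=\theta_{q\theta_p}$; $\theta_p\theta_q\theta_p\theta_q=\theta_p\theta_q$.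 For any regular $*$-semigroup $S$, $\mathbf P(S)=\{p\in S:p^2=p=p^*\}$ is a projection algebra with $q\theta_p=pqp$. On $P$ define $p\leq_{\mathscr F}q$ iff $p=q\theta_p$; $p\mathrel{\mathscr F}q$ iff $p\leq_{\mathscr F}q$ and $q\leq_{\mathscr F}p$. THE SEMIGROUP $\mathsf{PG}(P)$. A $P$-path is a tuple $(p_1,\ldots,p_k)$ ($k\geq1$) with $p_1\mathrel{\mathscr F}\cdots\mathrel{\mathscr F}p_k$, regarded as a morphism $p_1\to p_k$; the path category $\mathscr P(P)$ consists of all $P$-paths under $(p_1,\ldots,p_k)\circ(p_k,\ldots,p_l)=(p_1,\ldots,p_k,\ldots,p_l)$, with identities $(p)$. A pair $(e,f)\in P\times P$ is $p$-linked ($p\in P$) if $f=e\theta_p\theta_f$ and $e=f\theta_p\theta_e$. Let $\equiv$ be the (category) congruence on $\mathscr P(P)$ generated by all pairs $((p,p),(p))$ with $p\in P$, all $((p,q,p),(p))$ with $p\mathrel{\mathscr F}q$, and all $((e,e\theta_p,f),(e,f\theta_p,f))$ with $p\in P$ and $(e,f)$ $p$-linked. The class of $(p_1,\ldots,p_k)$ is denoted $[\![p_1,\ldots,p_k]\!]$. The free (projection-generated) regular $*$-semigroup $\mathsf{PG}(P)$ consists of all these classes, with $[\![p_1,\ldots,p_k]\!]^*=[\![p_k,\ldots,p_1]\!]$ and $[\![p_1,\ldots,p_k]\!]\bullet[\![q_1,\ldots,q_l]\!]=[\![p_1',\ldots,p_k',q_1',\ldots,q_l']\!]$, where, with $p'=q_1\theta_{p_k}$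 and $q'=p_k\theta_{q_1}$, $p_i'=p'\theta_{p_k}\cdots\theta_{p_i}$ and $q_j'=q'\theta_{q_1}\cdots\theta_{q_j}$. *)

(* Defs.v *)
From HB Require Import structures.
From mathcomp Require Import all_boot.
From mathcomp Require Import zify generic_quotient boolp.

Set Implicit Arguments.
Unset Strict Implicit.
Unset Printing Implicit Defensive.

Local Open Scope quotient_scope.


(* inl i is the upper vertex i and inr i the lower vertex i' *)
Definition vertex (n : nat) : finType := ('I_n + 'I_n)%type.

Record ptn (n : nat) := Ptn {
  blocks :> {set {set vertex n}};
  _ : partition blocks [set: vertex n] }.

HB.instance Definition _ n := [isSub of ptn n for @blocks n].
HB.instance Definition _ n := [Finite of ptn n by <:].

Section PartitionMonoid.
Variable n : nat.
Implicit Types (a b c : ptn n) (x y z : vertex n).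

Definition same a x y : bool := pblock a x == pblock a y.

Lemma ptnP a : partition a [set: vertex n]. Proof. exact: (valP a). Qed.

Lemma sameE a x y : same a x y = (y \in pblock a x).
Proof.
case/and3P: (ptnP a) => /eqP cov triv _.
by rewrite /same eq_pblock // cov inE.
Qed.

Lemma same_refl a x : same a x x. Proof. exact: eqxx. Qed.
Lemma same_sym a x y : same a x y = same a y x. Proof. exact: eq_sym. Qed.
Lemma same_trans a y x z : same a x y -> same a y z -> same a x z.
Proof. by rewrite /same => /eqP ->. Qed.

Lemma mem_pblockT a x : x \in pblock a x.
Proof. by rewrite -sameE same_refl. Qed.

Lemma pblock_memT a x : pblock a x \in blocks a.
Proof. by rewrite pblock_mem // (cover_partition (ptnP a)) inE. Qed.

Lemma block_eq a (B : {set vertex n}) x : B \in blocks a -> x \in B -> pblock a x = B.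
Proof. by move=> Ba xB; apply: def_pblock => //; case/and3P: (ptnP a). Qed.

Lemma block_inh a (B : {set vertex n}) : B \in blocks a -> exists x, x \in B.
Proof.
move=> Ba; case/and3P: (ptnP a) => _ _ n0.
case: (set_0Vmem B) => [B0|[x xB]]; last by exists x.
by move: n0; rewrite -B0 Ba.
Qed.

Lemma ptn_ext a b : (forall x y, same a x y = same b x y) -> a = b.
Proof.
move=> eqab; apply: val_inj => /=.
rewrite -(equivalence_partition_pblock (ptnP a)).
rewrite -(equivalence_partition_pblock (ptnP b)).
rewrite /equivalence_partition; apply: eq_imset => x.
by apply/setP => y; rewrite !inE -!sameE eqab.
Qed.

Section OfRel.
Variable (r : rel (vertex n)) (r_eq : equivalence_rel r).

Lemma ptn_of_subproof :
  partition (equivalence_partition r [set: vertex n]) [set: vertex n].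
Proof. by apply: equivalence_partitionP; move=> x y z _ _ _; apply: r_eq. Qed.

Definition ptn_of : ptn n := Ptn ptn_of_subproof.

Lemma same_ptn_of x y : same ptn_of x y = r x y.
Proof.
by rewrite sameE /= pblock_equivalence_partition ?inE // => u v w _ _ _.
Qed.

End OfRel.

(* The vertices of the product graph of a and b: inl (inl i), inl (inr i) and
   inr i are the i-th vertices of its upper, middle and lower rows. *)
Definition vertex3 : finType := ('I_n + 'I_n + 'I_n)%type.

Definition left_emb (x : vertex n) : vertex3 := inl x.
Definition right_emb (x : vertex n) : vertex3 :=
  match x with inl i => inl (inr i) | inr i => inr i end.
Definition outer_emb (x : vertex n) : vertex3 :=
  match x with inl i => inl (inl i) | inr i => inr i end.

Definition prod_edge a b : rel vertex3 := fun u v =>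
  [exists B in blocks a, (u \in left_emb @: B) && (v \in left_emb @: B)]
  || [exists B in blocks b, (u \in right_emb @: B) && (v \in right_emb @: B)].

Definition prod_rel a b : rel (vertex n) := fun x y =>
  connect (prod_edge a b) (outer_emb x) (outer_emb y).

Lemma prod_edge_sym a b : symmetric (prod_edge a b).
Proof.
by move=> u v; rewrite /prod_edge; congr (_ || _);
  apply: eq_existsb => B; rewrite [(u \in _) && _]andbC.
Qed.

Lemma prod_rel_equiv a b : equivalence_rel (prod_rel a b).
Proof.
move=> x y z; rewrite /prod_rel connect0; split=> // xy.
by rewrite (same_connect (sym_connect_sym (@prod_edge_sym a b)) xy).
Qed.

Definition ptn_mul a b : ptn n := ptn_of (prod_rel_equiv a b).

Lemma ptn_one_subproof :
  equivalence_rel (fun x y : vertex n =>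
    match x, y with inl i, inl j | inl i, inr j | inr i, inl j | inr i, inr j =>
      i == j end).
Proof. by case=> i [] j [] k; split=> // /eqP ->. Qed.

Definition ptn_one : ptn n := ptn_of ptn_one_subproof.

Definition flip (x : vertex n) : vertex n :=
  match x with inl i => inr i | inr i => inl i end.

Lemma flipK : involutive flip. Proof. by case. Qed.

Lemma ptn_star_subproof a :
  partition [set flip @: (B : {set vertex n}) | B in blocks a] [set: vertex n].
Proof.
have -> : [set: vertex n] = flip @: [set: vertex n].
  apply/setP => x; rewrite inE; symmetry; apply/imsetP.
  by exists (flip x); rewrite ?inE ?flipK.
by rewrite (imset_partition _ _ (inv_inj flipK)) ptnP.
Qed.

Definition ptn_star a : ptn n := Ptn (ptn_star_subproof a).

(* Colourings: a function on the vertices is given by its two rows. *)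
Definition rows (T : Type) (u l : 'I_n -> T) (x : vertex n) : T :=
  match x with inl i => u i | inr i => l i end.

Definition resp (T : Type) a (f : vertex n -> T) : Prop :=
  forall x y, same a x y -> f x = f y.

Lemma block_same a (B : {set vertex n}) x y :
  B \in blocks a -> x \in B -> y \in B -> same a x y.
Proof. by move=> Ba xB yB; rewrite /same !(block_eq Ba) // . Qed.

Lemma left_edge a b x y : same a x y -> prod_edge a b (left_emb x) (left_emb y).
Proof.
rewrite sameE => xy; apply/orP; left; apply/existsP; exists (pblock a x).
by rewrite pblock_memT !imset_f // mem_pblockT.
Qed.

Lemma right_edge a b x y : same b x y -> prod_edge a b (right_emb x) (right_emb y).
Proof.
rewrite sameE => xy; apply/orP; right; apply/existsP; exists (pblock b x).
by rewrite pblock_memT !imset_f // mem_pblockT.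
Qed.

Lemma prod_edgeP a b u v : prod_edge a b u v ->
  (exists x y, [/\ u = left_emb x, v = left_emb y & same a x y]) \/
  (exists x y, [/\ u = right_emb x, v = right_emb y & same b x y]).
Proof.
case/orP => /existsP [B /and3P [Ba /imsetP [x xB ->] /imsetP [y yB ->]]].
  by left; exists x, y; split=> //; apply: block_same Ba xB yB.
by right; exists x, y; split=> //; apply: block_same Ba xB yB.
Qed.

Definition rows3 (T : Type) (u m l : 'I_n -> T) (w : vertex3) : T :=
  match w with inl (inl i) => u i | inl (inr i) => m i | inr i => l i end.

Lemma connect_rows3 (T : Type) a b (u m l : 'I_n -> T) v w :
  resp a (rows u m) -> resp b (rows m l) ->
  connect (prod_edge a b) v w -> rows3 u m l v = rows3 u m l w.
Proof.
move=> ra rb /connectP [p + ->].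
elim: p v => [|v' p IH] v //= /andP [e /IH <-] {IH}.
case: (prod_edgeP e) => - [x [y [-> -> s]]].
  by case: x y s => i [] j /ra.
by case: x y s => i [] j /rb.
Qed.

Lemma sameM a b x y : same (ptn_mul a b) x y <->
  (forall (T : Type) (u m l : 'I_n -> T),
     resp a (rows u m) -> resp b (rows m l) -> rows u l x = rows u l y).
Proof.
rewrite same_ptn_of /prod_rel; split=> [c T u m l ra rb|H].
  by have := connect_rows3 ra rb c; case: (x) (y) => i [] j.
have csym : connect_sym (prod_edge a b).
  exact/sym_connect_sym/prod_edge_sym.
pose f := root (prod_edge a b).
have fe v w : prod_edge a b v w -> f v = f w.
  by move=> /connect1 c; apply/(rootP csym).
pose u i := f (inl (inl i)); pose m i := f (inl (inr i)); pose l i := f (inr i).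
have ra : resp a (rows u m).
  by move=> v w /(left_edge b) /fe; case: v w => i [] j.
have rb : resp b (rows m l).
  by move=> v w /(right_edge a) /fe; case: v w => i [] j.
have := H _ _ _ _ ra rb.
by case: (x) (y) => i [] j /= h; apply/(rootP csym).
Qed.

Lemma resp_mul (T : Type) a b (u m l : 'I_n -> T) :
  resp a (rows u m) -> resp b (rows m l) -> resp (ptn_mul a b) (rows u l).
Proof. by move=> ra rb x y /sameM H; apply: H ra rb. Qed.

Lemma resp_comp (T T' : Type) (g : T -> T') a (u l : 'I_n -> T) :
  resp a (rows u l) -> resp a (rows (g \o u) (g \o l)).
Proof. by move=> r x y /r; case: x y => i [] j /= ->. Qed.

Lemma resp_mulI (T : Type) a b (u l : 'I_n -> T) : resp (ptn_mul a b) (rows u l) ->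
  exists m : 'I_n -> option T,
    resp a (rows (Some \o u) m) /\ resp b (rows m (Some \o l)).
Proof.
move=> r.
have csym : connect_sym (prod_edge a b).
  exact/sym_connect_sym/prod_edge_sym.
pose g w := omap (rows u l) [pick x | connect (prod_edge a b) (outer_emb x) w].
have gE w w' : prod_edge a b w w' -> g w = g w'.
  move=> e; rewrite /g; congr (omap _ _); apply: eq_pick => x.
  by rewrite (same_connect1r csym e).
have go x : g (outer_emb x) = Some (rows u l x).
  rewrite /g; case: pickP => [y c|/(_ x)]; last by rewrite connect0.
  by congr Some; apply: r; rewrite same_ptn_of.
exists (fun i => g (inl (inr i))); split=> x y.
  move/(left_edge b)/gE; case: x y => i [] j //=;
  by rewrite -?(go (inl _)) -?(go (inr _)).
move/(right_edge a)/gE; case: x y => i [] j //=;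
by rewrite -?(go (inl _)) -?(go (inr _)).
Qed.

Lemma ptn_mulA : associative ptn_mul.
Proof.
move=> a b c; apply: ptn_ext => x y; apply/idP/idP => /sameM H;
  apply/sameM => T u m l.
- move=> /resp_mulI [k [rak rbk]] rc.
  have := H _ (Some \o u) k (Some \o l) rak.
  have rc' := resp_comp (@Some T) rc.
  move/(_ (resp_mul rbk rc')); case: (x) (y) => i [] j /= [] //.
- move=> ra /resp_mulI [k [rbk rck]].
  have ra' := resp_comp (@Some T) ra.
  have := H _ (Some \o u) k (Some \o l) (resp_mul ra' rbk) rck.
  by case: (x) (y) => i [] j /= [].
Qed.

Lemma same_one x y : same ptn_one x y =
  match x, y with inl i, inl j | inl i, inr j | inr i, inl j | inr i, inr j =>
      i == j end.
Proof. exact: same_ptn_of. Qed.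

Lemma resp_one (T : Type) (u l : 'I_n -> T) : resp ptn_one (rows u l) <-> u =1 l.
Proof.
split=> [r i|e x y]; first by apply: (r (inl i) (inr i)); rewrite same_one.
by rewrite same_one; case: x y => i [] j /eqP -> /=.
Qed.

Lemma same_resp a x y :
  (forall (T : Type) (u l : 'I_n -> T), resp a (rows u l) -> rows u l x = rows u l y) ->
  same a x y.
Proof.
move=> /(_ _ (fun i => pblock a (inl i)) (fun i => pblock a (inr i))) H.
have /H : resp a (rows (fun i => pblock a (inl i)) (fun i => pblock a (inr i))).
  by move=> v w /eqP; case: v w => i [] j.
by rewrite /same; case: (x) (y) => i [] j /= ->.
Qed.

Lemma ptn_mul1 : left_id ptn_one ptn_mul.
Proof.
move=> a; apply: ptn_ext => x y; apply/idP/idP => [/sameM H|s].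
  by apply: same_resp => T u l r; apply: H r; apply/resp_one.
apply/sameM => T u m l /resp_one um /(_ _ _ s).
by case: (x) (y) => i [] j /=; rewrite ?um.
Qed.

Lemma ptn_mulr1 : right_id ptn_one ptn_mul.
Proof.
move=> a; apply: ptn_ext => x y; apply/idP/idP => [/sameM H|s].
  by apply: same_resp => T u l r; apply: H r _; apply/resp_one.
apply/sameM => T u m l /(_ _ _ s) + /resp_one um.
by case: (x) (y) => i [] j /=; rewrite ?um.
Qed.

Lemma same_star a x y : same (ptn_star a) x y = same a (flip x) (flip y).
Proof.
have fI := inv_inj flipK.
rewrite !sameE.
have -> : pblock (ptn_star a) x = flip @: pblock a (flip x).
  apply: block_eq; first by apply: imset_f; apply: pblock_memT.
  by rewrite -{1}[x]flipK imset_f // mem_pblockT.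
by rewrite -{1}[y]flipK mem_imset.
Qed.

Lemma resp_star (T : Type) a (u l : 'I_n -> T) :
  resp (ptn_star a) (rows u l) <-> resp a (rows l u).
Proof.
have E x : rows u l (flip x) = rows l u x by case: x.
split=> r x y s; first by rewrite -!E; apply: r; rewrite same_star !flipK.
by rewrite -[x]flipK -[y]flipK !E; apply: r; rewrite -same_star.
Qed.

Lemma ptn_starK : involutive ptn_star.
Proof. by move=> a; apply: ptn_ext => x y; rewrite !same_star !flipK. Qed.

Lemma ptn_starM a b : ptn_star (ptn_mul a b) = ptn_mul (ptn_star b) (ptn_star a).
Proof.
apply: ptn_ext => x y; rewrite same_star.
have E T (u l : 'I_n -> T) z : rows l u (flip z) = rows u l z by case: z.
apply/idP/idP => /sameM H; apply/sameM => T u m l.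
  move=> /resp_star rb /resp_star ra.
  by have := H _ l m u ra rb; rewrite !E.
by move=> ra rb; rewrite !E; apply: (H _ l m u); apply/resp_star.
Qed.

Lemma ptn_mul_star_mul a : ptn_mul (ptn_mul a (ptn_star a)) a = a.
Proof.
apply: ptn_ext => x y; apply/idP/idP => [/sameM H|s].
  apply: same_resp => T u l r; apply: (H _ _ _ _ _ r).
  by apply: (resp_mul r); apply/resp_star.
apply/sameM => T u m l /resp_mulI [k [r1 /resp_star r2]] r3.
have {r3} := resp_comp (@Some T) r3 => r3.
suff : rows (Some \o u) (Some \o l) x = rows (Some \o u) (Some \o l) y.
  by case: (x) (y) => i [] j /= [].
case: x y s => i [] j s /=.
- exact: (r1 _ _ s).
- by move: (r1 _ _ s) (r2 _ _ s) (r3 _ _ s) => /= -> <- ->.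
- by move: (r1 _ _ s) (r2 _ _ s) (r3 _ _ s) => /= <- -> ->.
- exact: (r3 _ _ s).
Qed.

End PartitionMonoid.

HB.instance Definition _ n :=
  isMonoid.Build (ptn n) (@ptn_mulA n) (@ptn_mul1 n) (@ptn_mulr1 n).

Section Auxiliary.

Lemma dihedral (T : finType) (e : rel T) (s t : T -> T) w :
  involutive s -> involutive t -> t w = w -> s w <> w ->
  (forall z v, e z v -> [\/ v = z, v = s z | v = t z]) ->
  (forall z, connect e z (s z)) -> (forall z, connect e z (t z)) ->
  exists w', [/\ w' != w, connect e w w', (s w' = w' \/ t w' = w') &
    forall z, connect e w z -> s z = z \/ t z = z -> z = w \/ z = w'].
Proof.
move=> sK tK tw sw eE es et; pose r z := t (s z).
have rI : injective r by apply: inj_comp; apply: inv_inj.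
set N := order r w; have rN : iter N r w = w by apply: iter_order.
have N0 : 0 < N by apply: order_gt0.
have inj_it k j : k < N -> j < N -> iter k r w = iter j r w -> k = j.
  by move=> kN jN E; rewrite -(findex_iter kN) -(findex_iter jN) E.
have itI k x y : iter k r x = iter k r y -> x = y.
  by elim: k => // k IH /rI.
have rtr z : r (t (r z)) = t z by rewrite /r tK sK.
have tk k : k <= N -> t (iter k r w) = iter (N - k) r w.
  move=> kN; apply: (itI k); rewrite -iterD subnKC // rN.
  by elim: k {kN} => [|k IH] //; rewrite iterSr rtr.
have sk k : k < N -> s (iter k r w) = iter (N - k.+1) r w.
  by move=> kN; rewrite -tk //= /r tK.
have ec z : fconnect r w z -> exists2 k, k < N & z = iter k r w.
  by move=> c; exists (findex r w z); [apply: findex_max | rewrite iter_findex].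
have fit k : fconnect r w (iter k r w) by apply: fconnect_iter.
have eO z : connect e w z -> fconnect r w z.
  case/connectP => p + ->; elim/last_ind: p => [|p v IH] /=; first by rewrite connect0.
  rewrite rcons_path last_rcons => /andP [/IH/ec [k kN ->]] /eE [] -> //.
    by rewrite sk.
  by rewrite tk // ltnW.
have Oe k : connect e w (iter k r w).
  elim: k => [|k IH] /=; first by rewrite connect0.
  by apply: connect_trans IH _; apply: connect_trans (es _) (et _).
have N1 : 1 < N.
  rewrite ltn_neqAle N0 andbT; apply/eqP => N1; apply: sw.
  by move: rN; rewrite -N1 /= /r => h; rewrite -[LHS]tK h.
have h2 : N./2 < N by lia.
exists (iter N./2 r w); split=> //.
- by apply/eqP => h; have /= := @inj_it N./2 0 h2 N0 h; lia.
- have := odd_double_half N; case: (odd N) => /= hN.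
    by left; rewrite sk //; congr (iter _ _ _); lia.
  by right; rewrite tk ?(ltnW h2) //; congr (iter _ _ _); lia.
move=> z /eO/ec [k kN ->] [].
  rewrite sk // => h; have := @inj_it (N - k.+1) k _ kN h.
  by move=> E; right; congr (iter _ _ _); lia.
rewrite tk ?(ltnW kN) // => h; case: (posnP k) => [->|k0]; first by left.
have := @inj_it (N - k) k _ kN h => E; right; congr (iter _ _ _); lia.
Qed.

Lemma foldr_nc (L : eqType) (X : Type) (act : L -> X -> X) (w : seq L) z :
  (forall y, involutive (act y)) ->
  (forall y, y \in w -> count_mem y w = 2) ->
  (forall y y', subseq [:: y; y'; y; y'] w -> y = y') ->
  foldr act z w = z.
Proof.
move=> aK; move: {2}(size w) (leqnn (size w)) => k.
elim: k w z => [|k IH] [|x v] z // sz cnt nc.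
have xv : x \in v.
  by rewrite -has_pred1 has_count; have := cnt x (mem_head _ _); rewrite /= eqxx; lia.
case/splitPr: xv sz cnt nc => v1 v2 sz cnt nc.
have cx : count_mem x v1 + count_mem x v2 = 0.
  by have := cnt x (mem_head _ _); rewrite /= count_cat /= eqxx; lia.
have sub1 : subseq v1 (x :: v1 ++ x :: v2).
  by apply: subseq_trans (subseq_cons _ x); apply: prefix_subseq.
have sub2 : subseq v2 (x :: v1 ++ x :: v2).
  apply: subseq_trans (subseq_cons _ x); apply: subseq_trans (suffix_subseq _ _).
  exact: subseq_cons.
have dis y : y \in v1 -> y \in v2 -> False.
  move=> y1 y2; have yx : x = y.
    apply: nc => /=; rewrite eqxx.
    rewrite -[[:: y; x; y]]/([:: y] ++ [:: x; y]); apply: cat_subseq.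
      by rewrite sub1seq.
    by rewrite /= eqxx sub1seq.
  by move: y1; rewrite -yx -has_pred1 has_count; lia.
have cntE y : y != x -> count_mem y (x :: v1 ++ x :: v2) = count_mem y v1 + count_mem y v2.
  by move=> /negbTE h; rewrite /= count_cat /= eq_sym h.
rewrite /= foldr_cat /= (IH v1) ?(IH v2) ?aK //.
- by move: sz; rewrite /= size_cat /=; lia.
- move=> y yv; have yx : y != x.
    by apply: contraTneq yv => ->; rewrite -has_pred1 has_count; lia.
  rewrite -(cnt y) ?(mem_subseq sub2) // cntE //.
  suff -> : count_mem y v1 = 0 by [].
  by apply/count_memPn; apply/negP => /dis /(_ yv).
- by move=> y y' h; apply: nc; apply: subseq_trans h sub2.
- by move: sz; rewrite /= size_cat /=; lia.
- move=> y yv; have yx : y != x.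
    by apply: contraTneq yv => ->; rewrite -has_pred1 has_count; lia.
  rewrite -(cnt y) ?(mem_subseq sub1) // cntE //.
  suff -> : count_mem y v2 = 0 by rewrite addn0.
  by apply/count_memPn; apply/negP => /(dis _ yv).
- by move=> y y' h; apply: nc; apply: subseq_trans h sub1.
Qed.

Lemma foldr_revK (X I : Type) (c : I -> X -> X) (s : seq I) z :
  (forall i, involutive (c i)) -> foldr c (foldr c z s) (rev s) = z.
Proof.
move=> cK; elim: s z => //= i s IH z.
by rewrite rev_cons -cats1 foldr_cat /= cK.
Qed.

End Auxiliary.

Section TemperleyLieb.
Variable n : nat.
Implicit Types (a b : ptn n) (x y : vertex n).

(* Position on the boundary of the rectangle, read clockwise as
   1, ..., n, n', ..., 1'. A partition can be drawn without crossings inside the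
   rectangle iff no two distinct blocks interleave in this order. *)
Definition boundary_pos x : nat :=
  match x with inl i => i | inr i => n + (n - i.+1) end.

Definition all2block a : bool := [forall B in blocks a, #|B| == 2].

Definition planar a : bool :=
  [forall x1, forall x2, forall x3, forall x4,
    [&& boundary_pos x1 < boundary_pos x2, boundary_pos x2 < boundary_pos x3,
        boundary_pos x3 < boundary_pos x4, same a x1 x3 & same a x2 x4]
    ==> same a x1 x2].

Definition is_tl : {pred ptn n} := fun a => all2block a && planar a.

Lemma planarP a : reflect
  (forall x1 x2 x3 x4, boundary_pos x1 < boundary_pos x2 ->
    boundary_pos x2 < boundary_pos x3 -> boundary_pos x3 < boundary_pos x4 ->
    same a x1 x3 -> same a x2 x4 -> same a x1 x2) (planar a).
Proof.
apply: (iffP idP) => [H x1 x2 x3 x4 h1 h2 h3 h4 h5|H].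
  move/forallP/(_ x1)/forallP/(_ x2)/forallP/(_ x3)/forallP/(_ x4): H.
  by rewrite h1 h2 h3 h4 h5.
apply/forallP => x1; apply/forallP => x2; apply/forallP => x3; apply/forallP => x4.
by apply/implyP => /and5P [h1 h2 h3 h4 h5]; apply: H h4 h5.
Qed.

Lemma boundary_pos_inj : injective boundary_pos.
Proof.
move=> [] i [] j /= e; have := ltn_ord i; have := ltn_ord j.
- by move=> _ _; congr inl; apply: val_inj.
- by lia.
- by lia.
- by move=> h1 h2; congr inr; apply: val_inj => /=; lia.
Qed.

Definition mate a x : vertex n := odflt x [pick y | (y != x) && same a x y].

Lemma mateP a x : all2block a -> mate a x != x /\ forall y, same a x y = (y == x) || (y == mate a x).
Proof.
move=> /forallP/(_ (pblock a x)); rewrite pblock_memT /= => /cards2P [y [z [yz E]]].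
have sE t : same a x t = (t == y) || (t == z) by rewrite sameE E !inE.
rewrite /mate; case: pickP => [t /= /andP [tx]|H].
  have := same_refl a x; rewrite !sE => /orP [] /eqP xE /orP [] /eqP tE; subst.
  - by rewrite eqxx in tx.
  - by split=> // t; rewrite sE.
  - by split=> // t; rewrite sE orbC.
  - by rewrite eqxx in tx.
have := H y; have := H z; have := same_refl a x.
rewrite !sE !eqxx orbT !andbT => /orP [] /eqP -> => [/negbFE|_ /negbFE].
  by move/eqP=> h; rewrite h eqxx in yz.
by rewrite (negbTE yz).
Qed.

Lemma all2blockP a : (forall x, exists y, y != x /\ forall z, same a x z = (z == x) || (z == y)) ->
  all2block a.
Proof.
move=> H; apply/forallP => B; apply/implyP => Ba.
have [x xB] := block_inh Ba; have [y [yx E]] := H x.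
suff -> : B = [set x; y] by rewrite cards2 (eq_sym x) yx.
by apply/setP => z; rewrite -(block_eq Ba xB) -sameE E !inE.
Qed.

Lemma mateK a : all2block a -> involutive (mate a).
Proof.
move=> H x; have [n1 E1] := mateP x H; have [n2 E2] := mateP (mate a x) H.
have : same a (mate a x) x by rewrite same_sym E1 eqxx orbT.
by rewrite E2 eq_sym (negbTE n1) /= => /eqP <-.
Qed.

Lemma same_mate a x : all2block a -> same a x (mate a x).
Proof. by move=> H; have [_ ->] := mateP x H; rewrite eqxx orbT. Qed.

Lemma all2block_mul a b : all2block a -> all2block b -> all2block (ptn_mul a b).
Proof.
move=> Ha Hb; apply: all2blockP => x.
pose s (w : vertex3 n) : vertex3 n := match w with inl y => inl (mate a y) | inr i => inr i end.
pose t (w : vertex3 n) : vertex3 n := match w with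
  | inl (inl i) => inl (inl i)
  | inl (inr i) => right_emb (mate b (inl i))
  | inr i => right_emb (mate b (inr i)) end.
have tr y : t (right_emb y) = right_emb (mate b y) by case: y.
have rI : injective (@right_emb n) by move=> [] i [] j //= [->].
have sK : involutive s by case=> [y|i] //=; rewrite mateK.
have tK : involutive t by case=> [[]|] //= i; rewrite tr mateK.
have eE z v : prod_edge a b z v -> [\/ v = z, v = s z | v = t z].
  case/prod_edgeP => - [y [y' [-> ->]]].
    have [_ ->] := mateP y Ha; case/orP => /eqP ->; by [constructor 1 | constructor 2].
  have [_ ->] := mateP y Hb; case/orP => /eqP ->; first by constructor 1.
  by constructor 3; rewrite tr.
have es z : connect (prod_edge a b) z (s z).
  by case: z => [y|i] //=; apply/connect1/(left_edge b)/same_mate.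
have et z : connect (prod_edge a b) z (t z).
  case: z => [[i|i]|i] //=; apply: connect1.
    by apply: (@right_edge _ a b (inl i)); apply: same_mate.
  by apply: (@right_edge _ a b (inr i)); apply: same_mate.
have ft i : t (inl (inl i)) = inl (inl i) by [].
have fs i : s (inr i) = inr i by [].
have ns i : s (inl (inl i)) <> inl (inl i).
  by case=> /eqP; have [/negbTE ->] := mateP (inl i) Ha.
have ns' i : s (inl (inr i)) <> inl (inr i).
  by case=> /eqP; have [/negbTE ->] := mateP (inr i) Ha.
have nt i : t (inr i) <> inr i.
  by move/(rI _ (inr i))/eqP; have [/negbTE ->] := mateP (inr i) Hb.
have nt' i : t (inl (inr i)) <> inl (inr i).
  by move/(rI _ (inl i))/eqP; have [/negbTE ->] := mateP (inl i) Hb.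
have fixP z : s z = z \/ t z = z -> exists y, z = outer_emb y.
  by case: z => [[i|i]|i] [] // h; first [case: (ns' _ h) | case: (nt' _ h) |
    by exists (inl i) | by exists (inr i)].
have fixO y : s (outer_emb y) = outer_emb y \/ t (outer_emb y) = outer_emb y.
  by case: y => i; [right | left].
have oI : injective (@outer_emb n) by move=> [] i [] j //= [->].
suff [w' [w'n c f u]] : exists w', [/\ w' != outer_emb x, connect (prod_edge a b) (outer_emb x) w',
   (s w' = w' \/ t w' = w') & forall z, connect (prod_edge a b) (outer_emb x) z ->
     s z = z \/ t z = z -> z = outer_emb x \/ z = w'].
  have [y yE] := fixP _ f; exists y; split.
    by apply: contraNneq w'n => <-; rewrite yE.
  move=> z; rewrite same_ptn_of /prod_rel; apply/idP/idP => [cz|].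
    case: (u _ cz (fixO z)) => [/oI -> | ]; first by rewrite eqxx.
    by rewrite yE => /oI ->; rewrite eqxx orbT.
  by case/orP => /eqP ->; rewrite ?connect0 // -yE.
case: (x) => i.
  by apply: (@dihedral _ (prod_edge a b) s t) => //; apply: ns.
have [|||||w' [h1 h2 h3 h4]] := @dihedral _ (prod_edge a b) t s (inr i) tK sK.
- by [].
- exact: nt.
- by move=> z v /eE [->|->|->]; [constructor 1|constructor 3|constructor 2].
- by [].
- by [].
exists w'; split=> //; first by case: h3; [right|left].
by move=> z cz h; apply: h4 => //; case: h; [right|left].
Qed.

Definition boundary : seq (vertex n) :=
  [seq inl i | i <- enum 'I_n] ++ rev [seq inr i | i <- enum 'I_n].

Lemma boundary_sorted : sorted (relpre boundary_pos ltn) boundary.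
Proof.
have E : map boundary_pos boundary = iota 0 n ++ iota n n.
  rewrite map_cat; congr cat.
    by rewrite -map_comp -val_enum_ord; apply: eq_map.
  have -> : iota n n = rev (map (fun i => n + (n - i.+1)) (iota 0 n)).
    apply: (@eq_from_nth _ 0); rewrite ?size_rev ?size_map !size_iota // => i ilt.
    by rewrite nth_rev size_map size_iota // (nth_map 0) ?size_iota ?nth_iota; lia.
  by rewrite -val_enum_ord map_rev -!map_comp; congr rev; apply: eq_map.
by rewrite -sorted_map E -(iotaD 0 n n) iota_ltn_sorted.
Qed.

Lemma mem_boundary x : x \in boundary.
Proof.
rewrite mem_cat mem_rev; case: x => i; apply/orP; [left|right];
by apply/mapP; exists i; rewrite ?mem_enum.
Qed.

Lemma boundary_uniq : uniq boundary.
Proof.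
apply: (sorted_uniq (leT := relpre boundary_pos ltn)) boundary_sorted.
  by move=> y x z /=; apply: ltn_trans.
by move=> x /=; rewrite ltnn.
Qed.

Lemma count_boundary (P : pred (vertex n)) : count P boundary = #|P|.
Proof.
rewrite cardE -size_filter; apply: perm_size.
apply: uniq_perm; [exact: filter_uniq boundary_uniq|exact: enum_uniq|].
by move=> x; rewrite mem_filter mem_boundary mem_enum andbT.
Qed.

Lemma foldr_tl (X : Type) a (c : vertex n -> X -> X) z :
  is_tl a -> (forall x, involutive (c x)) -> resp a c ->
  foldr c z boundary = z.
Proof.
move=> /andP [H2 /planarP nc] cK r.
pose act (B : {set vertex n}) := if [pick x in B] is Some x then c x else id.
have actE x : c x = act (pblock a x).
  rewrite /act; case: pickP => [y|/(_ x)]; last by rewrite mem_pblockT.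
  by rewrite -sameE => /r.
have -> : foldr c z boundary = foldr act z (map (pblock a) boundary).
  by rewrite foldr_map; elim: boundary => //= x s ->; rewrite actE.
apply: foldr_nc => [B||B C].
- by rewrite /act; case: pickP => [x _ |_ y].
- move=> B /mapP [x _ ->]; rewrite count_map count_boundary.
  rewrite -[RHS](eqP (implyP (forallP H2 _) (pblock_memT a x))).
  by apply: eq_card => y; rewrite -sameE same_sym !inE.
case/subseqP => m sz; rewrite -map_mask.
have tr : transitive (relpre boundary_pos ltn).
  by move=> y x t /=; apply: ltn_trans.
have := subseq_sorted tr (mask_subseq m _) boundary_sorted.
case: (mask m boundary) => [|x1 [|x2 [|x3 [|x4 [|? ?]]]]] //= H [B1 C1 B2 C2].
case/and4P: H => h1 h2 h3 _.
rewrite B1 C1; apply/eqP; apply: (nc _ _ _ _ h1 h2 h3); apply/eqP; congruence.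
Qed.

(* Two involutions that generate a dihedral group of order 6. *)
Definition refl3 (k : nat) (z : option bool) : option bool :=
  match k, z with
  | 1, None => Some true | 1, Some true => None
  | 2, None => Some false | 2, Some false => None
  | _, _ => z end.

Lemma refl3K k : involutive (refl3 k).
Proof. by case: k => [|[|[|k]]] [[]|]. Qed.

Lemma foldr_boundary (X : Type) (u l : 'I_n -> X -> X) z :
  foldr (rows u l) z boundary =
  foldr u (foldr l z (rev (enum 'I_n))) (enum 'I_n).
Proof. by rewrite foldr_cat -map_rev !foldr_map. Qed.

Lemma planar_mul a b : is_tl a -> is_tl b -> planar (ptn_mul a b).
Proof.
move=> ta tb; apply/planarP => x1 x2 x3 x4 h1 h2 h3 s13 s24.
apply/negPn/negP => s12.
have H2 : all2block (ptn_mul a b).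
  by case/andP: ta tb => ta _ /andP [tb _]; apply: all2block_mul.
have csym : connect_sym (prod_edge a b).
  exact/sym_connect_sym/prod_edge_sym.
pose col (w : vertex3 n) : nat :=
  if connect (prod_edge a b) (outer_emb x1) w then 1 else
  if connect (prod_edge a b) (outer_emb x2) w then 2 else 0.
have colE v w : prod_edge a b v w -> col v = col w.
  by move=> e; rewrite /col !(same_connect1r csym e).
pose u i := refl3 (col (inl (inl i))); pose m i := refl3 (col (inl (inr i))).
pose l i := refl3 (col (inr i)).
have uK i : involutive (u i) by apply: refl3K.
have mK i : involutive (m i) by apply: refl3K.
have lK i : involutive (l i) by apply: refl3K.
have Ea z := @foldr_tl _ a (rows u m) z ta _ _.
have Eb z := @foldr_tl _ b (rows m l) z tb _ _.
have {}Ea z : foldr u (foldr m z (rev (enum 'I_n))) (enum 'I_n) = z.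
  rewrite -foldr_boundary; apply: Ea => [[]|] //.
  by move=> v w /(left_edge b) /colE; case: v w => i [] j; rewrite /= /u /m => ->.
have {}Eb z : foldr m (foldr l z (rev (enum 'I_n))) (enum 'I_n) = z.
  rewrite -foldr_boundary; apply: Eb => [[]|] //.
  by move=> v w /(right_edge a) /colE; case: v w => i [] j; rewrite /= /l /m => ->.
have E z : foldr (rows u l) z boundary = z.
  by rewrite foldr_boundary -(foldr_revK (enum 'I_n) (foldr l z _) mK) Eb Ea.
have {}E z : foldr (fun v => refl3 (col (outer_emb v))) z boundary = z.
  by rewrite -[RHS]E; elim: boundary => //= v s ->; case: v.
have inj := boundary_pos_inj.
have d x y : boundary_pos x < boundary_pos y -> x == y = false.
  by move=> h; apply/eqP => xy; rewrite xy ltnn in h.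
have c1 v : connect (prod_edge a b) (outer_emb x1) (outer_emb v) = (v == x1) || (v == x3).
  have -> : connect (prod_edge a b) (outer_emb x1) (outer_emb v) =
      same (ptn_mul a b) x1 v by rewrite same_ptn_of.
  have [_ E1] := mateP x1 H2; rewrite E1; move: s13; rewrite E1.
  by rewrite eq_sym d 1?(ltn_trans h1) //= => /eqP ->.
have c2 v : connect (prod_edge a b) (outer_emb x2) (outer_emb v) = (v == x2) || (v == x4).
  have -> : connect (prod_edge a b) (outer_emb x2) (outer_emb v) =
      same (ptn_mul a b) x2 v by rewrite same_ptn_of.
  have [_ E1] := mateP x2 H2; rewrite E1; move: s24; rewrite E1.
  by rewrite eq_sym d 1?(ltn_trans h2) //= => /eqP ->.
pose S := [:: x1; x2; x3; x4].
have : filter (mem S) boundary = S.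
  apply: (@irr_sorted_eq _ (relpre boundary_pos ltn)).
  - by move=> y x z /=; apply: ltn_trans.
  - by move=> x /=; rewrite ltnn.
  - apply: sorted_filter boundary_sorted.
    by move=> y x z /=; apply: ltn_trans.
  - by rewrite /= h1 h2 h3.
  by move=> v; rewrite mem_filter mem_boundary andbT.
have F z s : foldr (fun v => refl3 (col (outer_emb v))) z s =
             foldr (fun v => refl3 (col (outer_emb v))) z (filter (mem S) s).
  elim: s => //= v s IH; case: ifP => [_ |] /=; first by rewrite IH.
  rewrite !inE /col c1 c2; case: (v == x1) => //; case: (v == x2) => //.
  by case: (v == x3) => //; case: (v == x4).
move=> fE; have := E None; rewrite F fE /= /col !c1 !c2 !eqxx.
rewrite ?orbT (eq_sym x2) (eq_sym x4) (eq_sym x4 x3) ?(d _ _ h1) ?(d _ _ h2) ?(d _ _ h3) //=.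
by rewrite (d x1 x4) ?(ltn_trans h1 (ltn_trans h2 h3)).
Qed.

Lemma is_tl_mul a b : is_tl a -> is_tl b -> is_tl (ptn_mul a b).
Proof.
move=> ta tb; rewrite /is_tl planar_mul // andbT.
by case/andP: ta tb => ta _ /andP [tb _]; apply: all2block_mul.
Qed.

Lemma is_tl_one : is_tl (ptn_one n).
Proof.
apply/andP; split.
  apply: all2blockP => x; exists (flip x); split; first by case: x.
  by move=> z; rewrite same_one; case: x z => i [] j //=; rewrite ?orbF eq_sym.
apply/planarP => - [] i1 [] i2 [] i3 [] i4 /=; rewrite !same_one => h1 h2 h3 /eqP e1 /eqP e2;
  subst; have := ltn_ord i3; have := ltn_ord i4; lia.
Qed.

Lemma boundary_pos_flip x : boundary_pos (flip x) = (n + n).-1 - boundary_pos x.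
Proof. by case: x => i /=; have := ltn_ord i; lia. Qed.

Lemma boundary_pos_lt x : boundary_pos x < n + n.
Proof. by case: x => i /=; have := ltn_ord i; lia. Qed.

Lemma is_tl_star a : is_tl a -> is_tl (ptn_star a).
Proof.
case/andP => H /planarP nc; apply/andP; split.
  apply: all2blockP => x; have [h1 h2] := mateP (flip x) H.
  exists (flip (mate a (flip x))); split.
    by apply: contraNneq h1 => xE; rewrite -{2}xE flipK.
  move=> z; rewrite same_star h2.
  by rewrite !(can2_eq (@flipK n) (@flipK n)) flipK.
apply/planarP => x1 x2 x3 x4 h1 h2 h3; rewrite !same_star => s13 s24.
have := nc (flip x4) (flip x3) (flip x2) (flip x1); rewrite !boundary_pos_flip.
have := boundary_pos_lt x4 => h4.
rewrite ![same a (flip x4) _]same_sym s24 [same a (flip x3) _]same_sym s13.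
move=> /(_ _ _ _ isT isT) h.
have {}h : same a (flip x3) (flip x4) by apply: h; lia.
by apply: same_trans s13 _; apply: same_trans h _; rewrite same_sym.
Qed.

End TemperleyLieb.

HB.mixin Record isRegularStar S of Semigroup S := {
  star : S -> S;
  starK : involutive star;
  starM : forall x y : S, star (x * y)%g = (star y * star x)%g;
  mul_star_mul : forall x : S, (x * star x * x)%g = x }.

#[short(type="regStarType")]
HB.structure Definition RegularStar := { S of isRegularStar S & Semigroup S }.

HB.instance Definition _ n := isRegularStar.Build (ptn n)
  (@ptn_starK n) (@ptn_starM n) (@ptn_mul_star_mul n).

Record TL (n : nat) := MkTL { tl_val :> ptn n; _ : tl_val \in @is_tl n }.

HB.instance Definition _ n := [isSub of TL n for @tl_val n].
HB.instance Definition _ n := [Finite of TL n by <:].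

Lemma is_tl_closed n : umagma_closed (@is_tl n).
Proof. by split=> [|a b]; [apply: is_tl_one | apply: is_tl_mul]. Qed.

HB.instance Definition _ n :=
  SubChoice_isSubMonoid.Build (ptn n) (@is_tl n) (TL n) (@is_tl_closed n).

Definition tl_star n (a : TL n) : TL n := MkTL (is_tl_star (valP a)).

Lemma tl_starK n : involutive (@tl_star n).
Proof. by move=> a; apply/val_inj/ptn_starK. Qed.

Lemma tl_starM n (a b : TL n) : tl_star (a * b)%g = (tl_star b * tl_star a)%g.
Proof. by apply: val_inj; apply: ptn_starM. Qed.

Lemma tl_mul_star_mul n (a : TL n) : (a * tl_star a * a)%g = a.
Proof. by apply: val_inj; apply: ptn_mul_star_mul. Qed.

HB.instance Definition _ n := isRegularStar.Build (TL n)
  (@tl_starK n) (@tl_starM n) (@tl_mul_star_mul n).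

(* theta p q is q theta_p: maps act on the right in the usual notation, so a
   composite q theta_p theta_r is theta r (theta p q). *)
HB.mixin Record isProjAlg P of Choice P := {
  theta : P -> P -> P;
  thetaxx : forall p, theta p p = p;
  theta_idem : forall p x, theta p (theta p x) = theta p x;
  theta_absorb : forall p q, theta p (theta q p) = theta p q;
  thetaJ : forall p q x, theta p (theta q (theta p x)) = theta (theta p q) x;
  theta_alt : forall p q x,
    theta q (theta p (theta q (theta p x))) = theta q (theta p x) }.

#[short(type="projAlgType")]
HB.structure Definition ProjAlg := { P of isProjAlg P & Choice P }.

Section Projections.
Variable S : regStarType.

Definition is_proj : pred S := fun p => ((p * p)%g == p) && (star p == p).

Record proj := Proj { proj_val : S; _ : is_proj proj_val }.

HB.instance Definition _ := [isSub of proj for proj_val].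
HB.instance Definition _ := [Choice of proj by <:].

Implicit Types p q x : proj.

Lemma proj_idem p : (val p * val p)%g = val p.
Proof. by case/andP: (valP p) => /eqP. Qed.

Lemma proj_star p : star (val p) = val p.
Proof. by case/andP: (valP p) => _ /eqP. Qed.

Lemma proj_mul2 p q : (val p * val q * val p * val q)%g = (val p * val q)%g.
Proof.
rewrite -[RHS]mul_star_mul starM !proj_star !mulgA.
by rewrite -(mulgA (val p) (val q) (val q)) proj_idem -(mulgA _ (val p) (val p)) proj_idem.
Qed.

Lemma proj_theta_subproof p q : is_proj (val p * val q * val p)%g.
Proof.
apply/andP; split; apply/eqP; last by rewrite !starM !proj_star mulgA.
by rewrite !mulgA -(mulgA _ (val p) (val p)) proj_idem proj_mul2.
Qed.

Definition proj_theta p q : proj := Proj (proj_theta_subproof p q).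

Lemma proj_thetaxx p : proj_theta p p = p.
Proof. by apply: val_inj; rewrite /= !proj_idem. Qed.

Lemma proj_theta_idem p x : proj_theta p (proj_theta p x) = proj_theta p x.
Proof.
apply: val_inj; rewrite /= !mulgA proj_idem.
by rewrite -(mulgA _ (val p) (val p)) proj_idem.
Qed.

Lemma proj_theta_absorb p q : proj_theta p (proj_theta q p) = proj_theta p q.
Proof. by apply: val_inj; rewrite /= !mulgA proj_mul2. Qed.

Lemma proj_thetaJ p q x :
  proj_theta p (proj_theta q (proj_theta p x)) = proj_theta (proj_theta p q) x.
Proof. by apply: val_inj; rewrite /= !mulgA. Qed.

Lemma proj_theta_alt p q x :
  proj_theta q (proj_theta p (proj_theta q (proj_theta p x))) =
  proj_theta q (proj_theta p x).
Proof.
apply: val_inj; rewrite /= !mulgA proj_mul2 -!mulgA; do 3!congr (_ * _)%g.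
by have := proj_mul2 p q; rewrite -!mulgA.
Qed.

HB.instance Definition _ := isProjAlg.Build proj proj_thetaxx proj_theta_idem
  proj_theta_absorb proj_thetaJ proj_theta_alt.

End Projections.

Section ProjectionGenerated.
Variable P : projAlgType.
Implicit Types (p q e f x y : P) (s t : seq P).

Definition leF p q : bool := p == theta p q.
Definition relF p q : bool := leF p q && leF q p.

Definition is_ppath s : bool := (s != [::]) && sorted relF s.

Definition linked p e f : bool :=
  (f == theta f (theta p e)) && (e == theta e (theta p f)).

(* The congruence on the path category; the composite of the paths rcons s y
   and y :: t is rcons s y ++ t. *)
Inductive pg_cong : seq P -> seq P -> Prop :=
| pg_refl s : is_ppath s -> pg_cong s s
| pg_sym s t : pg_cong s t -> pg_cong t s
| pg_trans t s u : pg_cong s t -> pg_cong t u -> pg_cong s u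
| pg_comp s s' y t t' : pg_cong (rcons s y) (rcons s' y) ->
    pg_cong (y :: t) (y :: t') -> pg_cong (rcons s y ++ t) (rcons s' y ++ t')
| pg_pp p : pg_cong [:: p; p] [:: p]
| pg_pqp p q : relF p q -> pg_cong [:: p; q; p] [:: p]
| pg_linked p e f : linked p e f ->
    pg_cong [:: e; theta p e; f] [:: e; theta p f; f].

Record ppath := PPath { ppath_val :> seq P; _ : is_ppath ppath_val }.

HB.instance Definition _ := [isSub of ppath for ppath_val].
HB.instance Definition _ := [Choice of ppath by <:].

Definition pg_rel : rel ppath := fun u v => `[< pg_cong u v >].

Lemma pg_rel_refl : reflexive pg_rel.
Proof. by move=> s; apply/asboolP/pg_refl/valP. Qed.

Lemma pg_rel_sym : symmetric pg_rel.
Proof. by move=> s t; apply/asboolP/asboolP => /pg_sym. Qed.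

Lemma pg_rel_trans : transitive pg_rel.
Proof. by move=> t s u /asboolP st /asboolP tu; apply/asboolP/(pg_trans st tu). Qed.

Canonical pg_equiv := EquivRel pg_rel pg_rel_refl pg_rel_sym pg_rel_trans.

Definition PG : Type := {eq_quot pg_equiv}.
HB.instance Definition _ := Choice.on PG.
HB.instance Definition _ := EqQuotient.on PG.

Definition theta_act x q : P := theta q x.

(* scanl theta_act x [:: q_1; ...; q_l] lists the x theta_{q_1} ... theta_{q_j},
   1 <= j <= l; below, theta pk q1 is p' and theta q1 pk is q'. *)
Definition path_mul s t : seq P :=
  if s is p1 :: s' then if t is q1 :: t' then
    let pk := last p1 s' in
    rev (scanl theta_act (theta pk q1) (rev s)) ++ scanl theta_act (theta q1 pk) t
  else [::] else [::].

Lemma relFxx p : relF p p. Proof. by rewrite /relF /leF thetaxx eqxx. Qed.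

Lemma relF_sym p q : relF p q = relF q p. Proof. exact: andbC. Qed.

Lemma relFP p q : reflect (theta p q = p /\ theta q p = q) (relF p q).
Proof.
rewrite /relF /leF (eq_sym p) (eq_sym q).
by apply: (iffP andP) => - [h1 h2]; split; apply/eqP.
Qed.

Lemma res_relF p q x : relF p q -> theta p x = x -> relF x (theta q x).
Proof.
move=> /relFP [pq qp] px; apply/relFP; split.
  rewrite theta_absorb -[in theta x q]px -thetaJ pq; rewrite -[RHS]px.
  by rewrite theta_absorb.
by rewrite -thetaJ theta_absorb theta_absorb.
Qed.

Lemma mid_relF p q : relF (theta p q) (theta q p).
Proof. by apply/relFP; split; rewrite -thetaJ !theta_absorb. Qed.

Lemma linked_sym p e f : linked p e f -> linked p f e.
Proof. by rewrite /linked andbC. Qed.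

Lemma linked_path p e f : linked p e f -> is_ppath [:: e; theta p e; f].
Proof.
case/andP => /eqP fE /eqP eE; rewrite /is_ppath /= andbT.
have ee : theta e (theta p e) = e.
  by have := theta_alt p e f; rewrite -eE.
apply/andP; split; apply/relFP; split=> //.
- by rewrite -thetaJ ee.
- by rewrite -thetaJ -eE.
Qed.

Lemma is_ppath_rev s : is_ppath (rev s) = is_ppath s.
Proof.
rewrite /is_ppath -!size_eq0 size_rev rev_sorted; congr andb.
by apply: eq_sorted => x y; apply: relF_sym.
Qed.

Lemma pg_cong_path s t : pg_cong s t -> is_ppath s /\ is_ppath t.
Proof.
elim=> {s t} [s //|s t _ [] //|t s u _ [-> _] _ [_ ->] //||p|p q pq|p e f].
- move=> s s' y t t' _ [h1 h1'] _ [h2 h2']; split.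
    case/andP: h1 h2 => _; case: s => [|x s] /=; rewrite /is_ppath //=.
    by rewrite cat_path last_rcons => -> /=.
  case/andP: h1' h2' => _; case: s' => [|x s'] /=; rewrite /is_ppath //=.
  by rewrite cat_path last_rcons => -> /=.
- by rewrite /is_ppath /= relFxx.
- by rewrite /is_ppath /= (relF_sym q p) pq.
- move=> l; split; first exact: linked_path l.
  by rewrite -is_ppath_rev; apply/linked_path/linked_sym.
Qed.

Lemma pg_cong_rev s t : pg_cong s t -> pg_cong (rev s) (rev t).
Proof.
elim=> {s t} [s h|s t _|t s u _ h1 _ h2||p|p q pq|p e f l].
- by apply: pg_refl; rewrite is_ppath_rev.
- exact: pg_sym.
- exact: pg_trans h1 h2.
- move=> s s' y t t' _; rewrite !rev_rcons => h1 _; rewrite !rev_cons => h2.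
  by rewrite !rev_cat !rev_rcons -!cat_rcons; apply: pg_comp.
- exact: pg_pp.
- exact: pg_pqp.
- by apply: pg_sym; apply/pg_linked/linked_sym.
Qed.

Lemma pg_cong_last s t x : pg_cong s t -> last x s = last x t.
Proof.
move=> h; elim: h x => {s t} [s|s t _ IH|t s u _ IH1 _ IH2||p|p q pq|p e f l] x //.
  by rewrite IH1.
by move=> s' y t t' _ _ _ IH x0; rewrite !last_cat !last_rcons; apply: (IH y).
Qed.

Lemma pg_cong_head s t x : pg_cong s t -> head x s = head x t.
Proof.
move=> /pg_cong_rev /(pg_cong_last x); rewrite -(revK s) -(revK t) !revK.
by case: s t => [|a s] [|b t]; rewrite ?rev_cons ?last_rcons.
Qed.

Lemma scanl_path x s : is_ppath s -> is_ppath (scanl theta_act x s).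
Proof.
case: s => [|q t] //; rewrite /is_ppath /= => pt.
have : theta q (theta_act x q) = theta_act x q by apply: theta_idem.
elim: t q pt {x}(theta_act x q) => //= r t IH q /andP [qr pt] y qy.
rewrite (res_relF qr qy) /=; apply: IH pt _ _; exact: theta_idem.
Qed.

Lemma ppath_cat s t x : is_ppath s -> is_ppath t ->
  relF (last x s) (head x t) -> is_ppath (s ++ t).
Proof.
case: s => // y s; case: t => // z t; rewrite /is_ppath /= cat_path /=.
by move=> -> -> ->.
Qed.

Lemma path_mul_mid p s q t x :
  relF (last x (rev (scanl theta_act (theta (last p s) q) (rev (p :: s)))))
       (head x (scanl theta_act (theta q (last p s)) (q :: t))).
Proof.
rewrite [p :: s]lastI rev_rcons /= rev_cons last_rcons /theta_act !theta_idem.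
exact: mid_relF.
Qed.

Lemma path_mul_path s t : is_ppath s -> is_ppath t -> is_ppath (path_mul s t).
Proof.
case: s => [|p s] //; case: t => [|q t] // ps pt.
apply: ppath_cat (path_mul_mid p s q t p).
  by rewrite is_ppath_rev; apply: scanl_path; rewrite is_ppath_rev.
exact: scanl_path.
Qed.

Lemma scanl_linked p e f x : linked p e f ->
  exists e1 f1, [/\ linked p e1 f1,
    scanl theta_act x [:: e; theta p e; f] = [:: e1; theta p e1; f1] &
    scanl theta_act x [:: e; theta p f; f] = [:: e1; theta p f1; f1]].
Proof.
case/andP => /eqP fE /eqP eE.
pose e1 := theta e x; pose f1 := theta f (theta p e1).
have ee1 : theta e e1 = e1 by apply: theta_idem.
have m1 : theta (theta p e) e1 = theta p e1.
  by rewrite -thetaJ -[in LHS]ee1 theta_alt ee1.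
have m2 : theta (theta p f) e1 = theta p f1 by rewrite -thetaJ.
exists e1, f1; split.
- apply/andP; split; apply/eqP.
    by rewrite {2}/f1 -thetaJ !theta_absorb.
  rewrite -m2 theta_absorb -[in theta e1 _]ee1 -thetaJ -eE.
  by rewrite theta_absorb ee1.
- by rewrite /= /theta_act -/e1 m1.
- by rewrite /= /theta_act -/e1 m2 /f1 theta_alt.
Qed.

Lemma foldl_scanl x s : s != [::] -> foldl theta_act x s = last x (scanl theta_act x s).
Proof. by elim: s x => //= y s IH x _; case: s IH => //= z s ->. Qed.

Lemma scanl_rcons x s y : scanl theta_act x (rcons s y) =
  rcons (scanl theta_act x s) (theta y (foldl theta_act x s)).
Proof. by rewrite -cats1 scanl_cat /= cats1. Qed.

Lemma pg_cong_scanl s t x : pg_cong s t ->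
  pg_cong (scanl theta_act x s) (scanl theta_act x t).
Proof.
move=> h; elim: h x => {s t} [s h|s t _ IH|t s u _ IH1 _ IH2||p|p q pq|p e f l] x.
- by apply: pg_refl; apply: scanl_path.
- exact: pg_sym.
- exact: pg_trans (IH1 x) (IH2 x).
- move=> s' y t t' _ IH1 _ IH2 x0.
  have h1 := IH1 x0; have := pg_cong_last x0 h1; move: h1.
  rewrite !scanl_cat !scanl_rcons !last_rcons !foldl_rcons => + e.
  rewrite /theta_act -/theta_act e.
  set z := theta y _ => h1; apply: pg_comp h1 _.
  by have := IH2 z; rewrite /= /theta_act theta_idem.
- by rewrite /= /theta_act theta_idem; apply: pg_pp.
- rewrite /= /theta_act; set y := theta p x.
  have py : theta p y = y by apply: theta_idem.
  have qy := res_relF pq py.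
  have -> : theta p (theta q y) = y.
    by rewrite -[in LHS]py thetaJ; case/relFP: pq => -> _.
  exact: pg_pqp.
- by have [e1 [f1 [l1 -> ->]]] := scanl_linked x l; apply: pg_linked.
Qed.

Lemma pg_cong_join s s' t t' x : pg_cong s s' -> pg_cong t t' ->
  relF (last x s) (head x t) -> pg_cong (s ++ t) (s' ++ t').
Proof.
move=> hs ht; have := pg_cong_last x hs; have := pg_cong_head x ht.
have [/andP [+ _] /andP [+ _]] := pg_cong_path hs.
have [/andP [+ _] /andP [+ _]] := pg_cong_path ht.
move: hs ht; case/lastP: s => // s y; case/lastP: s' => // s' y'.
case: t => // z t; case: t' => // z' t' hs ht _ _ _ _.
rewrite !last_rcons /= => ez ey r; subst y' z'.
rewrite -!cat_rcons; apply: pg_comp => //.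
rewrite -(cats1 (rcons s y)) -(cats1 (rcons s' y)); apply: pg_comp => //.
by apply: pg_refl; rewrite /is_ppath /= r.
Qed.

Lemma pg_cong_mul s s' t t' : pg_cong s s' -> pg_cong t t' ->
  pg_cong (path_mul s t) (path_mul s' t').
Proof.
move=> hs ht; have [ps ps'] := pg_cong_path hs; have [pt pt'] := pg_cong_path ht.
case: s hs ps => // p s hs ps; case: s' hs ps' => // p' s' hs ps'.
case: t ht pt => // q t ht pt; case: t' ht pt' => // q' t' ht pt'.
have /= el := pg_cong_last p hs; have /= eq := pg_cong_head p ht; subst q'.
rewrite /path_mul -el.
apply: pg_cong_join (path_mul_mid p s q t p).
  by apply/pg_cong_rev/pg_cong_scanl/pg_cong_rev.
exact: (pg_cong_scanl _ ht).
Qed.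

Definition ppath_mul (u v : ppath) : ppath :=
  PPath (path_mul_path (valP u) (valP v)).

Definition pg_mul : PG -> PG -> PG := lift_op2 PG ppath_mul.

Lemma pi_pg_mul : {morph \pi_PG : u v / ppath_mul u v >-> pg_mul u v}.
Proof.
move=> u v; unlock pg_mul; apply/eqmodP/asboolP.
have E (w : ppath) : pg_cong w (repr (\pi_PG w)).
  apply/asboolP; rewrite -[asbool _]/(pg_equiv w (repr (\pi_PG w))).
  by apply/eqmodP; rewrite reprK.
exact: pg_cong_mul.
Qed.

HB.instance Definition _ := hasMul.Build PG pg_mul.

End ProjectionGenerated.

(* Main.v *)
Require Import Defs.
From HB Require Import structures.
From mathcomp Require Import all_boot.
From mathcomp Require Import zify generic_quotient boolp.

Set Implicit Arguments.
Unset Strict Implicit.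
Unset Printing Implicit Defensive.
Local Open Scope quotient_scope.

(** Send a path of projections to the product of its vertices in the
    Temperley-Lieb monoid. This product is constant on congruence classes of paths and turns the product of paths into the product of the
    monoid ([path_prod_cong], [path_prod_mul]), so it induces a homomorphism from
    the free regular star-semigroup to the monoid. What has to be proved is that
    this homomorphism is injective and surjective.

    The product of a path determines its two end points, because
    [p_1 = a a*] and [p_k = a* a] when [a] is the product
    ([path_prod_star], [star_path_prod]). Hence injectivity says that two paths
    with the same end points are congruent ([cong_parallel]): each component of
    the complex whose vertices are projections, whose edges are the F-related
    pairs and whose 2-cells are the linked pairs is simply connected. All the
    2-cells that are needed are triangles: if [e] and [f] are F-related and
    [p f p = f], then [(e, p e p, f)] is congruent to [(e, f)] ([cong_insert]).

    Diagrams are encoded by words. List the vertices in the order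
    [1', ..., n', n, ..., 1] around the rectangle, and call a vertex closing if
    its partner comes before it. A noncrossing matching is determined by its set
    of closing vertices ([noncrossing_ext]), and a projection is already
    determined by those among [1', ..., n'], its lower word ([low_ext]).
    Conjugating a projection [p] by the hook [t_i], which joins [i] to [i + 1] in
    both rows, is a path edge as soon as [p t_i p = p], and it changes the lower
    word in a simple way. Writing U for opening and D for closing letters: UD at
    [(i, i + 1)] is left alone, DU becomes UD, UU becomes UD while one later D
    becomes U, and DD becomes UD while one earlier U becomes D ([move_cup],
    [move_raise], [move_openings], [move_closings]).

    The moves of type DU -> UD, called raising, form a terminating rewriting
    system whose critical pairs are squares of two far apart, hence commuting,
    hooks. Each such square is cut into two triangles, so that all maximal raising
    paths from a given projection are congruent ([raising_unique]). They
    contract the component to a point provided that every edge [(p, q)] is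
    coherent: the edge followed by a maximal raising path of [q] is congruent to a
    maximal raising path of [p]. For edges given by hooks this is an induction on
    the sum of the positions of the closing letters ([coherent_act]): a UU or DD
    edge is either the inverse of a raising edge, by [t_i t_j t_i = t_i] for
    adjacent hooks, or a side of a commuting square whose other sides are raising
    or lie at smaller projections. For an arbitrary edge, write [q] as
    [t_{i_1} ... t_{i_k} ... t_{i_1}] ([generated_proj]) and cut the edge into
    hook edges with further triangles ([cong_conj], [coherent_generated]).

    For surjectivity, [a] is a product of projections as soon as [a t_i] is, if
    [t_i] raises [a* a]; likewise on the other side. This reduces to an [a] such
    that neither [a* a] nor [a a*] can be raised. Both rows of [a] have equally
    many closing vertices, so these two projections have the same word, and [a]
    is itself a projection ([raised_right_proj], [is_path_prodP]). *)

(** * Regular star-semigroups and congruent paths *)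

Section PathCongruence.
Variable P : projAlgType.
Implicit Types (p q r e f : P).

Lemma relF_theta p q : leF p q -> relF p (theta q p).
Proof. by move/eqP => pq; have := mid_relF p q; rewrite -pq. Qed.

Lemma ppath_cons p q (s : seq P) : is_ppath (p :: q :: s) = relF p q && is_ppath (q :: s).
Proof. by []. Qed.

Lemma cong_cons p q (s s' : seq P) : relF p q -> pg_cong (q :: s) s' ->
  pg_cong (p :: q :: s) (p :: s').
Proof.
move=> pq c; rewrite -[p :: q :: s]/([:: p] ++ q :: s) -[p :: s']/([:: p] ++ s').
exact: (pg_cong_join (x := p) (pg_refl _) c).
Qed.

Lemma cong_catr (s s' : seq P) p (t : seq P) :
  pg_cong (rcons s p) (rcons s' p) -> is_ppath (p :: t) ->
  pg_cong (rcons s p ++ t) (rcons s' p ++ t).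
Proof. by move=> c pt; apply: pg_comp c _; apply: pg_refl. Qed.

Lemma cong_dup p (s : seq P) : is_ppath (p :: s) -> pg_cong (p :: p :: s) (p :: s).
Proof. exact: (cong_catr (s := [:: p]) (s' := [::]) (pg_pp p)). Qed.

Lemma cong_back p q (s : seq P) : relF p q -> is_ppath (p :: s) ->
  pg_cong (p :: q :: p :: s) (p :: s).
Proof. by move/pg_pqp; apply: (cong_catr (s := [:: p; q]) (s' := [::])). Qed.

(** The pair [(e, f)] is linked by [p], and one of the two sides of the linked square
    is degenerate because [theta p f = f]. *)
Lemma cong_insert p e f : relF e f -> theta p f = f ->
  pg_cong [:: e; theta p e; f] [:: e; f].
Proof.
move=> ef pf; have [efE feE] := relFP _ _ ef.
have lk : linked p e f.
  by rewrite /linked pf efE -{2}pf -thetaJ theta_idem thetaJ pf feE !eqxx.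
apply: pg_trans (pg_linked lk) _; rewrite pf.
apply: cong_cons => //; exact: pg_pp.
Qed.

(** For commuting projections this and its mirror image, with [s] and [t]
    exchanged, split the square with corners [p] and [theta t (theta s p)] into
    two triangles along its diagonal. *)
Lemma cong_commute (p s t : P) : leF p (theta s t) ->
  theta t (theta s p) = theta s (theta t p) ->
  theta t (theta s p) = theta (theta s t) p ->
  pg_cong [:: p; theta s p; theta t (theta s p)] [:: p; theta t (theta s p)].
Proof.
move=> pst c1 c2; apply: cong_insert; last by rewrite c1 theta_idem.
by rewrite c2; apply: relF_theta.
Qed.

(** An edge given by the conjugate [theta t s] of [s] is cut into edges given by [t],
    [s] and [t] again. Two triangles suffice: the end point lies below [t], and so do the
    two outer vertices of the last three. *)
Lemma cong_conj (p s t : P) : leF p (theta t s) -> leF p t -> leF (theta t p) s ->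
  leF (theta s (theta t p)) t ->
  pg_cong [:: p; theta t p; theta s (theta t p); theta (theta t s) p]
          [:: p; theta (theta t s) p].
Proof.
set p1 := theta t p => h h1 h2 h3; set p2 := theta s p1.
have E : theta (theta t s) p = theta t p2 by rewrite -thetaJ.
have r1 : relF p p1 := relF_theta h1.
have r2 : relF p1 p2 := relF_theta h2.
have r3 : relF p2 (theta t p2) := relF_theta h3.
have r : relF p (theta t p2) by rewrite -E; apply: relF_theta.
have tp1 : theta t p1 = p1 by apply: theta_idem.
have c1 : pg_cong [:: p; p1; theta t p2] [:: p; theta t p2].
  by apply: cong_insert => //; apply: theta_idem.
have c2 : pg_cong [:: p1; p2] [:: p1; theta t p2; p2].
  apply: pg_sym; have := pg_cong_rev (cong_insert (p := t) _ tp1).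
  by apply; rewrite relF_sym.
rewrite E; apply: pg_trans c1; apply: cong_cons => //.
apply: pg_trans (cong_catr (s := [:: p1]) (s' := [:: p1; theta t p2])
                           (t := [:: theta t p2]) c2 _) _.
  by rewrite /is_ppath /= r3.
have [_ /=/andP [r4 _]] := andP (pg_cong_path c2).2.
apply: cong_cons => //; apply: (cong_back (s := [::])) => //.
by rewrite relF_sym.
Qed.

Lemma cong_loop p (u : seq P) : is_ppath (p :: u) ->
  pg_cong (p :: u ++ rev (p :: u)) [:: p].
Proof.
elim: u p => [|q u IH] p; first by move=> _; apply: pg_pp.
rewrite ppath_cons => /andP [pq /IH {}IH].
have h : pg_cong ((q :: u ++ rev (q :: u)) ++ [:: p]) ([:: q] ++ [:: p]).
  apply: (pg_cong_join (x := p) IH (pg_refl _)) => //=.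
  by rewrite last_cat rev_cons last_rcons relF_sym.
rewrite rev_cons -cats1 [(q :: u) ++ _]catA.
exact: pg_trans (cong_cons pq h) (pg_pqp pq).
Qed.

End PathCongruence.

Section Projections.
Variable S : regStarType.
Implicit Types (p q r s t : proj S) (x y z : S).
Local Open Scope group_scope.

Lemma val_theta p q : val (theta p q) = val p * val q * val p.
Proof. by []. Qed.

Lemma leFE p q : leF p q = (val p * val q * val p == val p).
Proof. by rewrite /leF -val_eqE /= eq_sym. Qed.

(** That [p q] generates the right ideal of [p] already forces [p q p = p]. *)
Lemma leF_mul p q y : val p * val q * y = val p -> leF p q.
Proof.
move=> E; rewrite leFE; apply/eqP.
have E2 : val p * val q * val p * val q * y = val p by rewrite proj_mul2.
by rewrite -[RHS]E2 -[RHS]mulgA -[RHS]mulgA (mulgA (val p) (val q) y) E.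
Qed.

Lemma pairK p q : val p * val q * (val p * val q) = val p * val q.
Proof. by rewrite mulgA proj_mul2. Qed.

(** Both sides are [p s q], because products of two projections are idempotent; this
    is why products of paths respect linked pairs. *)
Lemma theta_square s p q :
  val p * (val (theta s p) * val q) = val p * (val (theta s q) * val q).
Proof.
rewrite !val_theta -!mulgA (mulgA (val s) (val q) (_ * _)) pairK.
by rewrite !mulgA proj_mul2.
Qed.

Lemma theta_absorbM p q x : val p * (val (theta q p) * x) = val p * (val q * x).
Proof. by rewrite val_theta !mulgA proj_mul2. Qed.

(** This joins the products of two restricted paths at the two middle vertices
    of their product. *)
Lemma theta_mid p q x y :
  x * val (theta p q) * (val (theta q p) * y) = x * val p * (val q * y).
Proof.
rewrite !val_theta -!mulgA; congr (x * _).
by rewrite !mulgA !proj_mul2.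
Qed.

Lemma leF_star p q x : leF p q -> x * star x = val q ->
  val p * x * star (val p * x) = val p.
Proof.
rewrite leFE starM proj_star => /eqP pq xE.
by rewrite !mulgA -(mulgA _ x) xE.
Qed.

Lemma theta_star p q : val (theta q p) = star (val p * val q) * (val p * val q).
Proof. by rewrite starM !proj_star val_theta mulgA; congr (_ * _); rewrite -mulgA proj_idem. Qed.

Lemma theta_mul_star p q : val (theta p q) = (val p * val q) * star (val p * val q).
Proof. by rewrite starM !proj_star val_theta mulgA; congr (_ * _); rewrite -mulgA proj_idem. Qed.

Lemma proj_commute p q : val p * val q * val p = val p * val q ->
  commute (val p) (val q).
Proof. by move=> E; have := congr1 star E; rewrite !starM !proj_star mulgA E. Qed.

Lemma leF_theta p s t : leF p (theta s t) ->
  [/\ leF p s, leF (theta s p) t & leF (theta t (theta s p)) s].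
Proof.
rewrite leFE val_theta => /eqP E; split.
- by apply: (@leF_mul _ _ (val t * val s * val p)); rewrite -[RHS]E !mulgA.
- by rewrite leFE !val_theta -[in X in _ == X]E !mulgA.
have E2 : val s * val t * val s * val t * val s = val s * val t * val s.
  by rewrite proj_mul2.
rewrite leFE !val_theta -[in X in _ == X]E; apply/eqP.
rewrite -[in RHS]E2 !mulgA; do 3!congr (_ * _).
Qed.

Lemma leF_theta_comp p s t : leF p s -> leF (theta s p) t -> leF p (theta s t).
Proof.
rewrite !leFE !val_theta => /eqP E1 /eqP E2; apply/eqP.
have E3 : val p * (val s * val p * val s) * val p = val p by rewrite !mulgA E1.
have E4 : val p * (val s * val p * val s * val t * (val s * val p * val s)) * val p =
  val p * val s * val p * (val s * val t * val s) * (val p * val s * val p).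
  by rewrite !mulgA.
by rewrite -[RHS]E3 -E2 E4 E1.
Qed.

Lemma right_proj_subproof x : is_proj (star x * x).
Proof.
by rewrite /is_proj starM starK eqxx andbT mulgA -(mulgA _ x) -mulgA mul_star_mul.
Qed.

Definition right_proj x : proj S := Proj (right_proj_subproof x).

Lemma mul_right_proj x : x * val (right_proj x) = x.
Proof. by rewrite mulgA mul_star_mul. Qed.

Lemma right_proj_mul x q : right_proj (x * val q) = theta q (right_proj x).
Proof. by apply: val_inj; rewrite val_theta /= starM proj_star !mulgA. Qed.

Lemma mul_leF_right_proj x q : leF (right_proj x) q ->
  x * val q * val (right_proj x) = x.
Proof.
rewrite leFE => /eqP E; rewrite -[in X in X * _ * _](mul_right_proj x).
by rewrite -(mulgA x) -mulgA E mul_right_proj.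
Qed.

Lemma commute_theta s t p : commute (val s) (val t) ->
  [/\ val (theta s t) = val s * val t,
      theta t (theta s p) = theta s (theta t p) &
      theta t (theta s p) = theta (theta s t) p].
Proof.
rewrite /commute => st.
have E : val (theta s t) = val s * val t by rewrite /= -mulgA -st mulgA proj_idem.
split=> //; apply: val_inj.
  by rewrite !val_theta !mulgA st -!mulgA st.
rewrite [RHS]val_theta E !val_theta !mulgA; congr (_ * _ * _ * _); exact: esym.
Qed.
End Projections.

(** * Products of paths *)

Section PathProduct.
Variable n : nat.
Implicit Types (p q r s t : proj (TL n)) (u v : seq (proj (TL n))) (a b : TL n).
Local Open Scope group_scope.

Definition path_prod u : TL n := \prod_(p <- u) val p.

Lemma path_prod_nil : path_prod [::] = 1. Proof. exact: big_nil. Qed.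

Lemma path_prod_cons p u : path_prod (p :: u) = val p * path_prod u.
Proof. exact: big_cons. Qed.

Lemma path_prod_cat u v : path_prod (u ++ v) = path_prod u * path_prod v.
Proof. exact: big_cat. Qed.

Lemma star1 : star (1 : TL n) = 1.
Proof. by rewrite -[LHS]mulg1 -[X in _ * X]starK -starM mulg1 starK. Qed.

Lemma path_prod_rev u : path_prod (rev u) = star (path_prod u).
Proof.
elim: u => [|p u IH]; first by rewrite path_prod_nil star1.
by rewrite rev_cons -cats1 path_prod_cat IH !path_prod_cons path_prod_nil mulg1 starM
           proj_star.
Qed.

Lemma path_prod_cong u v : pg_cong u v -> path_prod u = path_prod v.
Proof.
elim=> {u v} [//|u v _ -> //|u v w _ -> _ -> //|||p q|s p q].
- move=> u u' p v v' _ IH1 _; rewrite !path_prod_cat IH1 !path_prod_cons => IH2.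
  have pK x : path_prod (rcons x p) * val p = path_prod (rcons x p).
    by rewrite -cats1 path_prod_cat path_prod_cons path_prod_nil mulg1 -mulgA proj_idem.
  by rewrite -(pK u') -!mulgA IH2.
- by move=> p; rewrite !path_prod_cons mulgA proj_idem.
- move=> /andP [+ _]; rewrite leFE !path_prod_cons path_prod_nil mulg1.
  by rewrite mulgA => /eqP.
- by rewrite !path_prod_cons path_prod_nil mulg1 theta_square.
Qed.

(** Preceded by [x], the restriction of a path to [x] has the same product as the
    path: at each vertex [q] one uses [x (q x q) = x q], as [x q] is idempotent. *)
Lemma path_prod_scanl (x : proj (TL n)) u :
  val x * path_prod (scanl (@theta_act _) x u) = val x * path_prod u.
Proof.
by elim: u x => //= q u IH x; rewrite !path_prod_cons /theta_act IH theta_absorbM.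
Qed.

Lemma path_prod_mul u v : u != [::] -> v != [::] ->
  path_prod (path_mul u v) = path_prod u * path_prod v.
Proof.
case: u => // p u; case: v => // q v _ _; rewrite /path_mul lastI.
move: (last p u) (belast p u) => {}p {}u.
have E x y w : path_prod (scanl (@theta_act _) (theta x y) (x :: w)) =
    val (theta x y) * path_prod w.
  by rewrite /= /theta_act theta_idem path_prod_cons path_prod_scanl.
rewrite path_prod_cat path_prod_rev rev_rcons !E starM -path_prod_rev revK proj_star.
by rewrite theta_mid -cats1 path_prod_cat !path_prod_cons path_prod_nil mulg1.
Qed.

Lemma path_prod_star p u : is_ppath (p :: u) ->
  path_prod (p :: u) * star (path_prod (p :: u)) = val p.
Proof.
elim: u p => [|q u IH] p; first by rewrite path_prod_cons path_prod_nil mulg1 proj_star proj_idem.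
rewrite ppath_cons => /andP [/andP [pq _] /IH E].
by rewrite path_prod_cons; apply: leF_star pq E.
Qed.

Lemma star_path_prod p u : is_ppath (rcons u p) ->
  star (path_prod (rcons u p)) * path_prod (rcons u p) = val p.
Proof.
move=> h; rewrite -[in LHS](revK (rcons u p)) path_prod_rev starK rev_rcons.
by apply: path_prod_star; rewrite -rev_rcons is_ppath_rev.
Qed.

End PathProduct.

(** * Noncrossing matchings *)

(** Matchings of [0, N) are extended by the identity so that they are total
    functions. *)
Record noncrossing (N : nat) (m : nat -> nat) : Prop := Noncrossing {
  nc_inv : involutive m;
  nc_lt : forall x, x < N -> m x < N;
  nc_neq : forall x, x < N -> m x <> x;
  nc_out : forall x, N <= x -> m x = x;
  nc_in : forall x y, x < y < m x -> x < m y < m x }.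

(** Induction on the length of an arc: two matchings with the same closing points
    agree strictly inside an arc of one of them, so no point inside can be matched
    with its right end in the other one, and no point to the left of the arc can
    be matched with that end without crossing. *)
Lemma noncrossing_ext N m m' : noncrossing N m -> noncrossing N m' ->
  (forall x, x < N -> (m x < x) = (m' x < x)) -> m =1 m'.
Proof.
move=> [K L E O I] [K' L' E' O' I'] D.
have key d x : x < N -> x < m x -> m x <= x + d -> m' x = m x.
  elim: d x => [|d IH] x xN xm md; first by lia.
  have mN := L x xN.
  have inner u : x < u < m x -> m' u = m u.
    move=> h; have := I _ _ h => h2; have uN : u < N by lia.
    have := E u uN; case: (ltngtP u (m u)) => [c _|c _|<- //]; first by apply: IH; lia.
    have := IH (m u); rewrite K => h3; rewrite -[in LHS]h3 ?K' //; lia.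
  have Dx := D x xN; have Dy := D _ mN; rewrite K in Dy.
  have Ex := E' x xN.
  (* The partner of [m x] in [m'] is not strictly inside the arc of [x], and a partner to
     the left of [x] would force the partner of [x] in [m'] to be inside. *)
  have [c|c|c] := ltngtP (m' (m x)) x.
  - have := I' (m' (m x)) x; rewrite K' => h; have {}h : m' (m x) < m' x < m x by apply: h; lia.
    have h2 : x < m' x < m x by lia.
    have := inner _ h2; rewrite K' => h3; have := I _ _ h2; lia.
  - have h : x < m' (m x) < m x by lia.
    have := inner _ h; rewrite K' => /esym; have := I _ _ h => h2 h3.
    by have := K (m' (m x)); lia.
  - by rewrite -{1}c K'.
move=> x; case: (ltnP x N) => xN; last by rewrite O ?O'.
have := E x xN; have mN := L x xN.
case: (ltngtP x (m x)) => [c _|c _|<- //]; first by apply/esym/(key (m x)); lia.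
by have := key x (m x) mN; rewrite K => h; rewrite -[in RHS]h ?K' //; lia.
Qed.

Section Matching.
Variable n : nat.
Implicit Types (a b : ptn n) (v w : vertex n) (x y : nat).

(** The order [1', ..., n', n, ..., 1]: the lower row comes first, so that positions in
    it are the natural numbers below [n]. *)
Definition pos v : nat := match v with inr i => i | inl i => (n + n).-1 - i end.

Lemma pos_lt v : pos v < n + n.
Proof. by case: v => i /=; have := ltn_ord i; lia. Qed.

Lemma pos_boundary v : boundary_pos v = (n + n).-1 - pos v.
Proof. by case: v => i /=; have := ltn_ord i; lia. Qed.

Lemma pos_inj : injective pos.
Proof. by move=> v w E; apply: boundary_pos_inj; rewrite !pos_boundary E. Qed.

Lemma pos_flip v : pos (flip v) = (n + n).-1 - pos v.
Proof. by case: v => i /=; have := ltn_ord i; lia. Qed.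

Lemma pos_inr v : pos v < n -> exists2 i : 'I_n, v = inr i & pos v = i.
Proof. by case: v => i /=; have := ltn_ord i; [lia | exists i]. Qed.

Lemma pos_surj x : x < n + n -> exists v, pos v = x.
Proof.
move=> h; case: (ltnP x n) => xn; first by exists (inr (Ordinal xn)).
have h' : (n + n).-1 - x < n by lia.
by exists (inl (Ordinal h')) => /=; lia.
Qed.

Definition partner a x : nat :=
  if [pick v | pos v == x] is Some v then pos (mate a v) else x.

Lemma partner_pos a v : partner a (pos v) = pos (mate a v).
Proof.
rewrite /partner; case: pickP => [w /eqP/pos_inj -> //|/(_ v)]; by rewrite eqxx.
Qed.

Lemma partner_out a x : n + n <= x -> partner a x = x.
Proof.
move=> h; rewrite /partner; case: pickP => [v /eqP E|//].
by have := pos_lt v; rewrite E; lia.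
Qed.

Lemma partnerK a : is_tl a -> involutive (partner a).
Proof.
case/andP => H _ x; case: (ltnP x (n + n)) => [/pos_surj [v <-]|h].
  by rewrite !partner_pos mateK.
by rewrite !partner_out.
Qed.

Lemma partner_lt a x : x < n + n -> partner a x < n + n.
Proof. by case/pos_surj => v <-; rewrite partner_pos pos_lt. Qed.

Lemma partner_neq a x : is_tl a -> x < n + n -> partner a x <> x.
Proof.
case/andP => H _ /pos_surj [v <-]; rewrite partner_pos => /pos_inj E.
by have [/eqP] := mateP v H.
Qed.

Lemma partner_nc a x y : is_tl a -> x < y < partner a x -> x < partner a y < partner a x.
Proof.
move=> ta; case: (ltnP x (n + n)) => h; last by rewrite partner_out //; lia.
have K := partnerK ta; have := partner_lt a h => h2.
have := K x; have := K y.
case/pos_surj: h h2 => v <- h2 Ky Kv /andP [h3 h4].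
have : y < n + n by lia.
case/pos_surj => w E; subst y.
have [H /planarP nc] := andP ta.
have [_ sE] := mateP v H.
have d : same a v w = false.
  rewrite sE; apply/negP => /orP [] /eqP E; first by rewrite E ltnn in h3.
  by move: h4; rewrite partner_pos E ltnn.
have s1 := same_mate v H; have s2 := same_mate w H.
have b u : boundary_pos u = (n + n).-1 - pos u := pos_boundary u.
have pl := pos_lt; have pw := pl w; have pv := pl v.
rewrite !partner_pos in h4 h2 Ky Kv *.
have n1 : pos (mate a w) <> pos v.
  by move/pos_inj => E; move: d; rewrite same_sym -E s2.
have n2 : pos (mate a w) <> pos (mate a v).
  by move/pos_inj/(inv_inj (mateK H)) => E; rewrite E ltnn in h3.
have pmw := pl (mate a w).
case: (ltnP (pos (mate a w)) (pos v)) => c1.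
  have := nc (mate a v) w v (mate a w); rewrite !b.
  rewrite same_sym s1 s2 => /(_ _ _ _ isT isT) E.
  by move: d; rewrite (same_trans s1) // E //; lia.
case: (ltnP (pos (mate a v)) (pos (mate a w))) => c2; last by lia.
have := nc (mate a w) (mate a v) w v; rewrite !b same_sym s2 (same_sym a _ v) s1.
move=> /(_ _ _ _ isT isT) E; suff : same a (mate a w) (mate a v).
  move=> E2; move: d; by rewrite (same_trans s1) // same_sym; apply: same_trans s2 E2.
by apply: E; lia.
Qed.

Lemma partner_noncrossing a : is_tl a -> noncrossing (n + n) (partner a).
Proof.
move=> ta; split.
- exact: partnerK.
- exact: partner_lt.
- by move=> x; apply: partner_neq.
- exact: partner_out.
- by move=> x y; apply: partner_nc.
Qed.

Lemma partner_inj a b : is_tl a -> is_tl b -> partner a =1 partner b -> a = b.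
Proof.
case/andP => Ha _ /andP [Hb _] E; apply: ptn_ext => v w.
have [_ ->] := mateP v Ha; have [_ ->] := mateP v Hb.
by have := E (pos v); rewrite !partner_pos => /pos_inj ->.
Qed.

Lemma mate_uniq a v w : is_tl a -> v <> w -> same a v w -> mate a v = w.
Proof.
case/andP => H _ /eqP ne; have [_ ->] := mateP v H.
by rewrite eq_sym (negbTE ne) => /eqP.
Qed.

Lemma partner_star a x : is_tl a -> x < n + n ->
  partner (ptn_star a) x = (n + n).-1 - partner a ((n + n).-1 - x).
Proof.
move=> ta /pos_surj [v <-]; rewrite -pos_flip !partner_pos -pos_flip.
congr pos; have [H _] := andP ta; apply: mate_uniq; first exact: is_tl_star.
  move=> E; have [/eqP + _] := mateP (flip v) H; apply.
  by rewrite -[LHS]flipK -E.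
by rewrite same_star flipK same_mate.
Qed.

Definition closes a x : bool := partner a x < x.

Lemma closes_ext a b : is_tl a -> is_tl b ->
  (forall x, x < n + n -> closes a x = closes b x) -> a = b.
Proof.
move=> ta tb E; apply: partner_inj => //.
exact: (noncrossing_ext (partner_noncrossing ta) (partner_noncrossing tb)).
Qed.

Lemma closes_star a x : is_tl a -> x < n + n ->
  closes (ptn_star a) x = ~~ closes a ((n + n).-1 - x).
Proof.
move=> ta xn; rewrite /closes partner_star //.
have h : (n + n).-1 - x < n + n by lia.
have := partner_lt a h; have := partner_neq ta h; lia.
Qed.

(** Closing vertices of the upper row are read off the star, which reverses the
    order of positions. *)
Lemma closes_tl_ext a b : is_tl a -> is_tl b ->
  (forall x, x < n -> closes a x = closes b x) ->
  (forall x, x < n -> closes (ptn_star a) x = closes (ptn_star b) x) -> a = b.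
Proof.
move=> ta tb E E'; apply: closes_ext => // x xn; case: (ltnP x n) => [|h]; first exact: E.
have := E' ((n + n).-1 - x); rewrite !closes_star ?subKn; try lia.
Qed.

(** Arcs within the lower row of the right-hand factor survive in a product. *)
Lemma partner_mull a b x : is_tl a -> is_tl b -> x < n -> partner b x < n ->
  partner (ptn_mul a b) x = partner b x.
Proof.
move=> ta tb xn; have tab := is_tl_mul ta tb; have [H _] := andP tb.
have : x < n + n by lia.
case/pos_surj => v E; subst x; rewrite !partner_pos => mn.
congr pos; apply: mate_uniq => //; first by apply/eqP; rewrite eq_sym; have [] := mateP v H.
have := same_mate v H; case/pos_inr: mn => j -> _; case/pos_inr: xn => i -> _.
by move=> s; apply/sameM => T u m l _ /(_ _ _ s).
Qed.

(** The matching exchanges closing and opening vertices, so [n] of the [n + n]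
    vertices are closing; as the order of positions on the upper row is reversed, this
    means that both rows have the same number of closing vertices. *)
Lemma count_closes a : is_tl a ->
  \sum_(x < n) closes a x = \sum_(x < n) closes (ptn_star a) x.
Proof.
move=> ta; have [K L E O I] := partner_noncrossing ta.
have S : \sum_(x < n + n) closes a x = \sum_(x < n + n) ~~ closes a x.
  (* Sum over the partner instead: a vertex is closing iff its partner is not. *)
  rewrite (reindex_inj (h := fun x : 'I_(n + n) => Ordinal (L x (ltn_ord x)))) /=.
    apply: eq_bigr => x _; congr nat_of_bool; rewrite /closes K.
    by have := E x (ltn_ord x); lia.
  by move=> x y /(congr1 val) /= /(inv_inj K) /val_inj.
move: S; rewrite !big_split_ord /=.
have U : \sum_(i < n) closes a (n + i) = \sum_(i < n) ~~ closes (ptn_star a) i.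
  rewrite (reindex_inj rev_ord_inj) /=; apply: eq_bigr => i _; have := ltn_ord i => h.
  rewrite closes_star ?negbK //; last by lia.
  by congr (nat_of_bool (closes a _)) => /=; lia.
have U' : \sum_(i < n) ~~ closes a (n + i) = \sum_(i < n) closes (ptn_star a) i.
  rewrite (reindex_inj rev_ord_inj) /=; apply: eq_bigr => i _; have := ltn_ord i => h.
  rewrite closes_star //; last by lia.
  by congr (nat_of_bool (~~ closes a _)) => /=; lia.
have C (f : 'I_n -> bool) : \sum_(i < n) ~~ f i + \sum_(i < n) f i = n.
  rewrite -big_split /= -[RHS]card_ord -sum1_card; apply: eq_bigr => i _.
  by case: (f i).
rewrite U U'; have /= := C (fun i => closes a i).
have /= := C (fun i => closes (ptn_star a) i).
by do 4!move: (\sum_(i < n) _) => ?; lia.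
Qed.

End Matching.

(** * Hooks and multiplication by a hook *)

(** The matching obtained from [m] by joining [i] to [i.+1] and the former
    partners of [i] and [i.+1] to each other. *)
Definition cup_act (i : nat) (m : nat -> nat) (x : nat) : nat :=
  if x == i then i.+1 else if x == i.+1 then i else
  if m x == i then m i.+1 else if m x == i.+1 then m i else m x.

Section Hooks.
Variable n : nat.
Implicit Types (a b : ptn n) (v w : vertex n) (x y i : nat).

(** The matching of the identity diagram. *)
Definition reversal x : nat := if x < n + n then (n + n).-1 - x else x.

(** The four end points of the two arcs of a hook, the through strings, and the
    positions outside the diagram. *)
Variant hook_spec i x : nat -> Prop :=
| HookCupL of x = i : hook_spec i x i.+1
| HookCupR of x = i.+1 : hook_spec i x i
| HookCapR of x + i = (n + n).-1 : hook_spec i x x.-1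
| HookCapL of x + i.+1 = (n + n).-1 : hook_spec i x x.+1
| HookThrough y of x <> i & x <> i.+1 & x + i <> (n + n).-1 & x + i.+1 <> (n + n).-1
    & x < n + n & x + y = (n + n).-1 : hook_spec i x y
| HookOut of n + n <= x : hook_spec i x x.

Lemma hook_specP i x : i.+1 < n -> hook_spec i x (cup_act i reversal x).
Proof.
move=> h; rewrite /cup_act.
case: eqP => [->|x0]; first exact: HookCupL.
case: eqP => [->|x1]; first exact: HookCupR.
have [l0 l1] : i < n + n /\ i.+1 < n + n by lia.
rewrite /reversal l0 l1; case: (ltnP x) => xn.
  case: eqP => [E|E0].
    have -> : (n + n).-1 - i.+1 = x.-1 by lia.
    by apply: HookCapR; lia.
  case: eqP => [E|E1].
    have -> : (n + n).-1 - i = x.+1 by lia.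
    by apply: HookCapL; lia.
  by apply: HookThrough; lia.
do 2![case: eqP => [|_]; first by lia].
exact: HookOut.
Qed.

Lemma hook_noncrossing i : i.+1 < n -> noncrossing (n + n) (cup_act i reversal).
Proof.
move=> h; have S x := hook_specP x h; move: (cup_act i reversal) S => m S.
split=> [x|x|x|x|x y].
- by case: (m x) / (S x) => *; case: (m _) / (S _) => *; lia.
- by case: (m x) / (S x) => *; lia.
- by case: (m x) / (S x) => *; lia.
- by case: (m x) / (S x) => *; lia.
- by case: (m x) / (S x) => *; case: (m y) / (S y) => *; lia.
Qed.

Section OfMatching.
Variables (m : nat -> nat) (mN : noncrossing (n + n) m).

Definition matching_rel : rel (vertex n) := fun v w => (w == v) || (pos w == m (pos v)).

Lemma matching_rel_equiv : equivalence_rel matching_rel.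
Proof.
have K := nc_inv mN.
move=> u v w; rewrite /matching_rel eqxx; split=> // /orP [/eqP -> //|/eqP E].
rewrite E K orbC; congr (_ || _); last by apply/eqP/eqP => [->|/pos_inj].
by apply/eqP/eqP => [h|-> //]; apply: pos_inj; rewrite h E.
Qed.

Definition matching_ptn : ptn n := ptn_of matching_rel_equiv.

Lemma matching_ptn_tl : is_tl matching_ptn.
Proof.
have sE v w : same matching_ptn v w = (w == v) || (pos w == m (pos v)).
  exact: same_ptn_of.
apply/andP; split.
  apply: all2blockP => v; have [w E] := pos_surj (nc_lt mN (pos_lt v)).
  exists w; split=> [|z]; first by apply/eqP => wv; apply: (nc_neq mN (pos_lt v)); rewrite -E wv.
  by rewrite sE -E (inj_eq (@pos_inj n)).
apply/planarP => x1 x2 x3 x4; rewrite !pos_boundary !sE.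
have l1 := pos_lt x1; have l2 := pos_lt x2; have l3 := pos_lt x3; have l4 := pos_lt x4.
move=> h1 h2 h3 /orP [/eqP E|/eqP E13]; first by rewrite E in h2; lia.
move=> /orP [/eqP E|/eqP E24]; first by rewrite E in h3; lia.
have := nc_in mN (x := pos x4) (y := pos x3); have K := nc_inv mN.
by rewrite E13 E24 !K -E13; lia.
Qed.

Lemma partner_matching x : partner matching_ptn x = m x.
Proof.
case: (ltnP x (n + n)) => h; last by rewrite partner_out // (nc_out mN).
have [v E] := pos_surj h; have [w E'] := pos_surj (nc_lt mN h); rewrite -E' -E partner_pos.
congr pos; apply: mate_uniq; first exact: matching_ptn_tl.
  by move=> vw; apply: (nc_neq mN h); rewrite -E' -E vw.
by rewrite same_ptn_of /matching_rel E E' eqxx orbT.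
Qed.
End OfMatching.

(** Out of range the hook is the identity, so that the empty product of hooks is a hook. *)
Definition hook_ptn i : ptn n :=
  if @idP (i.+1 < n) is ReflectT h then matching_ptn (hook_noncrossing h) else ptn_one n.

Lemma hook_ptn_tl i : is_tl (hook_ptn i).
Proof.
by rewrite /hook_ptn; case: {-}_ / idP => h; [apply: matching_ptn_tl | apply: is_tl_one].
Qed.

Lemma same_hook i v w : i.+1 < n ->
  same (hook_ptn i) v w = (w == v) || (pos w == cup_act i reversal (pos v)).
Proof.
by rewrite /hook_ptn; case: {-}_ / idP => // h _; apply: same_ptn_of.
Qed.

Lemma partner_hook i x : i.+1 < n -> partner (hook_ptn i) x = cup_act i reversal x.
Proof.
by rewrite /hook_ptn; case: {-}_ / idP => // h _; apply: partner_matching.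
Qed.

(** It suffices to exhibit, for each vertex, a vertex in the same block of the
    product, and blocks have two elements. Blocks of products are detected by
    colourings, which transport the equality of colours along the two strings that end
    at [i'] and [(i + 1)']. *)
Lemma partner_mul_hook a i x : is_tl a -> i.+1 < n ->
  partner (ptn_mul a (hook_ptn i)) x = cup_act i (partner a) x.
Proof.
move=> ta hi; have tah := is_tl_mul ta (hook_ptn_tl i).
have [H _] := andP ta.
have K := partnerK ta.
case: (ltnP x (n + n)) => xn; last first.
  by rewrite /cup_act !(partner_out _ xn) !ifN_eq //; apply/eqP; lia.
have [v E] := pos_surj xn; subst x.
have hi' : i < n by lia.
pose v0 : vertex n := inr (Ordinal hi'); pose v1 : vertex n := inr (Ordinal hi).
have p0 : pos v0 = i by []. have p1 : pos v1 = i.+1 by [].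
have pE u w : pos u = pos w -> u = w := @pos_inj n u w.
have n01 : v0 <> v1 by move=> E; move: p1; rewrite -E p0; lia.
have Aw w : w <> v -> same (ptn_mul a (hook_ptn i)) v w ->
    partner (ptn_mul a (hook_ptn i)) (pos v) = pos w.
  by move=> wv s; rewrite partner_pos (mate_uniq _ _ s) // => /esym.
have C (T : Type) (u m l : 'I_n -> T) : resp a (rows u m) -> resp (hook_ptn i) (rows m l) ->
  [/\ rows u l v0 = rows u l v1, rows u m v0 = rows u m v1,
     forall w, rows u m w = rows u m (mate a w) &
     forall w, w <> v0 -> w <> v1 -> rows u m w = rows u l w].
  move=> ra rh; split=> [||w|].
  - by apply: (rh v0 v1); rewrite same_hook // p0 p1 /cup_act eqxx eqxx orbT.
  - apply: (rh (flip v0) (flip v1)); rewrite same_hook // !pos_flip p0 p1.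
    apply/orP; right; apply/eqP.
    by case: (cup_act _ _ _) / (hook_specP _ hi) => *; lia.
  - by apply: ra; apply: same_mate.
  case=> k // k0 k1; apply: (rh (inl k) (inr k)); rewrite same_hook //.
  apply/orP; right; apply/eqP; have := ltn_ord k.
  have : pos (inr k) <> i by rewrite -p0 => /pE.
  have : pos (inr k) <> i.+1 by rewrite -p1 => /pE.
  by case: (cup_act _ _ _) / (hook_specP _ hi) => /= *; lia.
have mn w : mate a w <> w by apply/eqP; have [] := mateP w H.
have mK := mateK H.
rewrite /cup_act; case: eqP => [|ne0].
  move=> /(pE _ v0) ->; rewrite partner_pos (@mate_uniq _ _ _ v1) //.
  by apply/sameM => T u m l ra rh; have [-> _ _ _] := C _ _ _ _ ra rh.
case: eqP => [|ne1].
  move=> /(pE _ v1) ->; rewrite partner_pos (@mate_uniq _ _ _ v0) //.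
    by move/esym.
  by apply/sameM => T u m l ra rh; have [-> _ _ _] := C _ _ _ _ ra rh.
have nv0 : v <> v0 by move=> E; apply: ne0; rewrite E.
have nv1 : v <> v1 by move=> E; apply: ne1; rewrite E.
rewrite (partner_pos a); case: eqP => [|me0].
  move=> /(pE _ v0) E; rewrite -p1 (partner_pos a); apply: Aw.
    by move=> E'; apply: n01; rewrite -E -E' mK.
  apply/sameM => T u m l ra rh; have [_ e1 e2 e3] := C _ _ _ _ ra rh.
  rewrite -!e3 //; first by rewrite e2 E e1 e2.
    by move=> E'; apply: nv1; rewrite -(mK v) E -E' mK.
case: eqP => [|me1].
  move=> /(pE _ v1) E; rewrite -[partner a i]/(partner a (pos v0)) (partner_pos a); apply: Aw.
    by move=> E'; apply: n01; rewrite -E -E' mK.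
  apply/sameM => T u m l ra rh; have [_ e1 e2 e3] := C _ _ _ _ ra rh.
  rewrite -!e3 //; first by rewrite e2 E -e1 e2.
    by move=> E'; apply: nv0; rewrite -(mK v) E -E' mK.
apply: Aw => //; apply/sameM => T u m l ra rh; have [_ e1 e2 e3] := C _ _ _ _ ra rh.
by rewrite -!e3 // => E; [apply: me0 | apply: me1]; rewrite E.
Qed.

End Hooks.

(** * Lower words of projections *)

Variant cup_act_spec (i : nat) (m : nat -> nat) (x : nat) : nat -> Prop :=
| CupLeft of x = i : cup_act_spec i m x i.+1
| CupRight of x = i.+1 : cup_act_spec i m x i
| CupMateL of x <> i & x <> i.+1 & x = m i : cup_act_spec i m x (m i.+1)
| CupMateR of x <> i & x <> i.+1 & x = m i.+1 : cup_act_spec i m x (m i)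
| CupOther of x <> i & x <> i.+1 & x <> m i & x <> m i.+1 : cup_act_spec i m x (m x).

Lemma cup_actP i m x : involutive m -> cup_act_spec i m x (cup_act i m x).
Proof.
move=> K; rewrite /cup_act; case: eqP => [|x0]; first exact: CupLeft.
case: eqP => [|x1]; first exact: CupRight.
case: eqP => [E|m0]; first by apply: CupMateL => //; rewrite -E K.
case: eqP => [E|m1]; first by apply: CupMateR => //; rewrite -E K.
by apply: CupOther => // E; [apply: m0 | apply: m1]; rewrite E K.
Qed.

Lemma cup_act_id i m x : involutive m -> m i = i.+1 -> cup_act i m x = m x.
Proof.
move=> K E; have E' : m i.+1 = i by rewrite -E K.
by case: (cup_act _ _ _) / (cup_actP i x K) => // [->|->|_ n1 e|n0 _ e];
  rewrite ?E ?E' //; [case: n1|case: n0]; rewrite e.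
Qed.

Section Words.
Variable n : nat.
Implicit Types (a b : TL n) (p q : proj (TL n)) (i j x : nat).
Local Open Scope group_scope.

Lemma TL_tl a : is_tl (tl_val a). Proof. exact: (valP a). Qed.

Lemma partner_TL a : noncrossing (n + n) (partner a).
Proof. exact: partner_noncrossing (TL_tl a). Qed.

Lemma TL_ext a b : partner a =1 partner b -> a = b.
Proof. move=> E; apply: val_inj; exact: partner_inj (TL_tl a) (TL_tl b) E. Qed.

Definition hook i : TL n := MkTL (hook_ptn_tl n i).

Lemma TL_partner_hook i x : i.+1 < n -> partner (hook i) x = cup_act i (reversal n) x.
Proof. exact: partner_hook. Qed.

Lemma TL_partner_mul_hook a i x : i.+1 < n ->
  partner (a * hook i) x = cup_act i (partner a) x.
Proof. exact: (partner_mul_hook x (TL_tl a)). Qed.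

Lemma TL_partner_star a x : x < n + n ->
  partner (star a) x = (n + n).-1 - partner a ((n + n).-1 - x).
Proof. exact: (partner_star (TL_tl a)). Qed.

Lemma TL_closes_star a x : x < n + n -> closes (star a) x = ~~ closes a ((n + n).-1 - x).
Proof. exact: (closes_star (TL_tl a)). Qed.

Lemma mul_hook_fix a i : i.+1 < n -> partner a i = i.+1 -> a * hook i = a.
Proof.
move=> h E; apply: TL_ext => x; rewrite TL_partner_mul_hook //.
exact: cup_act_id (nc_inv (partner_TL a)) E.
Qed.

Lemma hook_out i : n <= i.+1 -> hook i = 1.
Proof.
by move=> h; apply: val_inj; rewrite /= /hook_ptn; case: {-}_ / idP => //; lia.
Qed.

Lemma closes1 x : x < n -> closes (1 : TL n) x = false.
Proof.
move=> xn; have : x < n + n by lia.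
case/pos_surj => v E; subst x; rewrite /closes partner_pos.
rewrite (@mate_uniq _ _ v (flip v) (TL_tl 1)); first by rewrite pos_flip; lia.
  by case: v {xn}.
by rewrite same_one; case: v xn => i /=.
Qed.

Lemma hook_proj_subproof i : is_proj (hook i).
Proof.
case: (ltnP i.+1 n) => h; last first.
  by rewrite hook_out // /is_proj mulg1 star1 !eqxx.
apply/andP; split; apply/eqP.
  by apply: mul_hook_fix; rewrite ?TL_partner_hook /cup_act ?eqxx.
apply: TL_ext => x; rewrite TL_partner_hook //.
have S y := hook_specP y h; case: (ltnP x (n + n)) => xn; last first.
  by rewrite partner_out //; case: (cup_act _ _ _) / (S x) => *; lia.
rewrite TL_partner_star // TL_partner_hook //.
by case: (cup_act _ _ x) / (S x) => *; case: (cup_act _ _ _) / (S _) => *; lia.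
Qed.

Definition hook_proj i : proj (TL n) := Proj (hook_proj_subproof i).

(** The lower word of a projection, with the letters D for true and U for false. *)
Definition low p x : bool := (x < n) && closes (val p) x.

(** Lower arcs of [a] survive in [star a * a], whose lower arcs survive in
    [a * (star a * a) = a]. *)
Lemma closes_mul_star a x : x < n -> closes (star a * a) x = closes a x.
Proof.
move=> xn.
have E (b c : TL n) y : y < n -> partner c y < n -> partner (b * c) y = partner c y.
  exact: partner_mull (TL_tl b) (TL_tl c).
rewrite /closes; case: (ltnP (partner a x) n) => h; first by rewrite E.
case: (ltnP (partner (star a * a) x) n) => h'; last by lia.
by have := E a _ _ xn h'; rewrite mulgA mul_star_mul => ->.
Qed.

(** A projection is fixed by the star, so its upper word is its lower word. *)
Lemma low_ext p q : low p =1 low q -> p = q.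
Proof.
move=> E; apply: val_inj; apply: val_inj.
have {}E x : x < n -> closes (val p) x = closes (val q) x.
  by move=> xn; have := E x; rewrite /low xn.
apply: (closes_tl_ext (TL_tl _) (TL_tl _) E) => x xn.
by rewrite -![ptn_star _]/(tl_val (star _)) !proj_star; apply: E.
Qed.

(** Only the partners of [i] and [i.+1] could change their letter in the upper row,
    and they do so only if both of them are in the upper row. *)
Lemma closes_star_mul_hook a i x : i.+1 < n -> x < n ->
  (partner a i < n \/ partner a i.+1 < n) ->
  closes (star (a * hook i)) x = closes (star a) x.
Proof.
move=> h xn c; have xnn : x < n + n by lia.
rewrite !TL_closes_star // /closes TL_partner_mul_hook //; congr negb.
have : n <= (n + n).-1 - x by lia.
move: (_ - x) => y yn.
have K := nc_inv (partner_TL a).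
by case: (cup_act _ _ _) / (cup_actP i y K) => [e|e|_ _ e|_ _ e|_ _ _ _]; rewrite ?e ?K; lia.
Qed.

(** If [i] and [i.+1] both carry through strings, the hook joins the upper ends of
    these strings, and one of them becomes an opening vertex. *)
Lemma closes_mul_hook_cap a i : i.+1 < n -> n <= partner a i -> n <= partner a i.+1 ->
  exists2 x, x < n & closes (star (a * hook i)) x != closes (star a) x.
Proof.
move=> h c c'; have [K L E O I] := partner_TL a.
have l : partner a i.+1 < n + n by apply: L; lia.
exists ((n + n).-1 - partner a i.+1); first by lia.
rewrite !TL_closes_star /closes; try lia.
rewrite subKn; last by lia.
rewrite TL_partner_mul_hook // K /cup_act K eqxx !ifN_eq; try by apply/eqP; lia.
by have := I i i.+1; lia.
Qed.

Lemma conj_by_hook p i : val (theta (hook_proj i) p) = star (val p * hook i) * (val p * hook i).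
Proof. exact: (theta_star p (hook_proj i)). Qed.

Lemma conj_of_hook p i : val (theta p (hook_proj i)) = (val p * hook i) * star (val p * hook i).
Proof. exact: (theta_mul_star p (hook_proj i)). Qed.

Lemma low_conj_of_hook p i x : x < n ->
  low (theta p (hook_proj i)) x = closes (star (val p * hook i)) x.
Proof.
by move=> xn; rewrite /low xn conj_of_hook -[X in X * _]starK closes_mul_star.
Qed.

(** Conjugation by a hook preserves the rank unless the hook meets two through
    strings. *)
Lemma leF_hookP p i : i.+1 < n ->
  leF p (hook_proj i) <-> (partner (val p) i < n \/ partner (val p) i.+1 < n).
Proof.
move=> h; split.
  move/eqP => E; case: (ltnP (partner (val p) i) n) => c; first by left.
  case: (ltnP (partner (val p) i.+1) n) => c'; first by right.
  have [x xn] := closes_mul_hook_cap h c c'.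
  by rewrite -low_conj_of_hook // -E proj_star /low xn eqxx.
move=> c; apply/eqP; apply: low_ext => x; case: (ltnP x n) => xn; last first.
  by rewrite /low ltnNge xn.
by rewrite low_conj_of_hook // closes_star_mul_hook // proj_star /low xn.
Qed.

Lemma low_conj_by_hook p i x : i.+1 < n -> x < n ->
  low (theta (hook_proj i) p) x = (cup_act i (partner (val p)) x < x).
Proof.
by move=> h xn; rewrite /low xn conj_by_hook closes_mul_star // /closes TL_partner_mul_hook.
Qed.

End Words.

(** * Moves between projections *)

Section Moves.
Variable n : nat.
Implicit Types (p q : proj (TL n)) (i j x : nat).
Local Open Scope group_scope.

Notation "p ▷ i" := (theta (hook_proj n i) p) (at level 50, left associativity).

Definition move_letter (w : nat -> bool) (a b x : nat) : bool :=
  if x == a then false else if x == b then true else w x.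

Lemma low_out p x : n <= x -> low p x = false.
Proof. by rewrite /low ltnNge => ->. Qed.

Lemma lowE p x : x < n -> low p x = (partner (val p) x < x).
Proof. by rewrite /low => ->. Qed.

Lemma low_actE p i (w : nat -> bool) : i.+1 < n ->
  (forall x, x < n -> (cup_act i (partner (val p)) x < x) = w x) ->
  (forall x, n <= x -> w x = false) -> low (p ▷ i) =1 w.
Proof.
move=> h E E' x; case: (ltnP x n) => xn; last by rewrite low_out // E'.
by rewrite low_conj_by_hook // E.
Qed.

(** An opening letter followed by a closing letter is an arc, since anything else
    would cross. *)
Lemma cup_partner p i : ~~ low p i -> low p i.+1 -> partner (val p) i = i.+1.
Proof.
case: (ltnP i.+1 n) => h; last by rewrite (low_out p h).
rewrite !lowE; try lia.
have [K L E O I] := partner_TL (val p); move: (partner _) K L E O I => m K L E O I.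
move=> l0 l1; have := K i; have := K i.+1; have := I (m i.+1) i; rewrite K.
have := E i; have := E i.+1; move: l0 l1.
case: (ltngtP (m i.+1) i) => c; last by move=> *; rewrite -{1}c K.
  by move=> *; lia.
by move=> *; lia.
Qed.

Lemma move_cup p i : ~~ low p i -> low p i.+1 -> p ▷ i = p.
Proof.
move=> l0 l1; have h : i.+1 < n by move: l1; case: ltnP => // /low_out ->.
apply: val_inj; rewrite conj_by_hook mul_hook_fix ?(cup_partner l0) //.
by rewrite proj_star proj_idem.
Qed.

Lemma move_raise p i : i.+1 < n -> low p i -> ~~ low p i.+1 ->
  leF p (hook_proj n i) /\ low (p ▷ i) =1 move_letter (low p) i i.+1.
Proof.
move=> h l0 l1; have h' : i < n by lia.
have c0 := l0; have c1 := l1; rewrite lowE // in c0; rewrite lowE // in c1.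
have [K L E O I] := partner_TL (val p).
have [e0 e1] := (E i ltac:(lia), E i.+1 ltac:(lia)).
split; first by apply/leF_hookP => //; lia.
apply: low_actE => // [x xn|x xn]; rewrite /move_letter; last first.
  by rewrite !ifN_eq ?low_out //; apply/eqP; lia.
case: (cup_act _ _ _) / (cup_actP i x K) => [->|->|x0 x1 e|x0 x1 e|x0 x1 _ _].
- by rewrite eqxx; lia.
- by rewrite eqxx ifN_eq; [lia|apply/eqP; lia].
- by rewrite !ifN_eq ?lowE //; try (by apply/eqP); rewrite e K; lia.
- by rewrite !ifN_eq ?lowE //; try (by apply/eqP); rewrite e K; lia.
- by rewrite !ifN_eq ?lowE //; apply/eqP.
Qed.

(** The arcs of [i] and [i.+1] are nested, and after the move the right end of the
    inner one becomes the left end of an arc. *)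
Lemma move_openings p i : i.+1 < n -> ~~ low p i -> ~~ low p i.+1 ->
  leF p (hook_proj n i) ->
  exists c, [/\ i.+1 < c, low p c, low p i.+2 -> c = i.+2 &
                low (p ▷ i) =1 move_letter (low p) c i.+1].
Proof.
move=> h l0 l1 /(leF_hookP _ h) d; have h' : i < n by lia.
have c0 := l0; have c1 := l1; rewrite lowE // in c0; rewrite lowE // in c1.
have [K L E O I] := partner_TL (val p).
have [e0 e1] := (E i ltac:(lia), E i.+1 ltac:(lia)).
set m := partner _ in K L E O I d c0 c1 e0 e1 *.
have ne : m i <> i.+1 by move=> e; have := K i; rewrite e; lia.
have i1 := I i i.+1 ltac:(lia).
have cn : m i.+1 < n by lia.
exists (m i.+1); split.
- lia.
- by rewrite lowE // -/m K; lia.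
- case: (ltnP i.+2 n) => h2; last by rewrite low_out.
  rewrite lowE // -/m => l2; have := I (m i.+2) i.+1; rewrite K.
  have := I (m i.+2) i; rewrite K => h3 h4; have k2 := K i.+2.
  case: (ltngtP (m i.+2) i.+1) => c; first last.
  - by rewrite -[RHS]k2 c.
  - by have := E i.+2 ltac:(lia); lia.
  by case: (ltngtP (m i.+2) i) => c'; lia.
apply: low_actE => // [x xn|x xn]; rewrite /move_letter; last first.
  by rewrite !ifN_eq ?low_out //; apply/eqP; lia.
case: (cup_act _ _ _) / (cup_actP i x K) => [->|->|x0 x1 e|x0 x1 e|x0 x1 e e'].
- rewrite !ifN_eq ?lowE // -?/m; try (by apply/eqP; lia); lia.
- by rewrite eqxx ifN_eq; [lia|apply/eqP; lia].
- rewrite !ifN_eq ?lowE // -/m; try (by apply/eqP => //; lia); rewrite e K; lia.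
- by rewrite e eqxx; lia.
- by rewrite !ifN_eq ?lowE //; apply/eqP.
Qed.

(** The arcs of [i] and [i.+1] are nested, and after the move the left end of the
    inner one becomes the right end of an arc. *)
Lemma move_closings p i : i.+1 < n -> low p i -> low p i.+1 ->
  leF p (hook_proj n i) /\
  exists b, [/\ b < i, ~~ low p b, ~~ low p i.-1 -> b = i.-1 &
                low (p ▷ i) =1 move_letter (low p) i b].
Proof.
move=> h l0 l1; have h' : i < n by lia.
have c0 := l0; have c1 := l1; rewrite lowE // in c0; rewrite lowE // in c1.
have [K L E O I] := partner_TL (val p).
have [e0 e1] := (E i ltac:(lia), E i.+1 ltac:(lia)).
split; first by apply/leF_hookP => //; lia.
set m := partner _ in K L E O I c0 c1 e0 e1 *.
have ne : m i.+1 <> i by move=> e; have := K i.+1; rewrite e; lia.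
have i1 := I (m i.+1) i; rewrite K in i1; have {}i1 := i1 ltac:(lia).
exists (m i); split.
- lia.
- by rewrite lowE -/m; [rewrite K; lia|lia].
- rewrite lowE; last by lia.
  rewrite -/m => l2; have [e2 k2] := (E i.-1 ltac:(lia), K i.-1).
  have := I i.-1 i.
  by case: (ltngtP (m i.-1) i) => c; [lia|lia|rewrite -[in RHS]k2 c].
apply: low_actE => // [x xn|x xn]; rewrite /move_letter; last first.
  by rewrite !ifN_eq ?low_out //; apply/eqP; lia.
case: (cup_act _ _ _) / (cup_actP i x K) => [->|->|x0 x1 e|x0 x1 e|x0 x1 e e'].
- by rewrite eqxx; lia.
- rewrite !ifN_eq ?lowE // -?/m; try (by apply/eqP; lia); lia.
- by rewrite e eqxx ifN_eq; [lia|apply/eqP; lia].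
- rewrite !ifN_eq ?lowE // -/m; try (by apply/eqP => //; lia); rewrite e K; lia.
- by rewrite !ifN_eq ?lowE //; apply/eqP.
Qed.

(** The measure of the inductions below: raising increases it by one, and the moves of
    type UU and DD decrease it. *)
Definition area p : nat := \sum_(x < n) low p x * x.

Lemma area_move p q a b : low q =1 move_letter (low p) a b ->
  low p a -> ~~ low p b -> b < n -> area q + a = area p + b.
Proof.
move=> E la lb bn; have an : a < n by move: la; case: ltnP => // /low_out ->.
have ab : a <> b by move=> e; move: lb; rewrite -e la.
rewrite /area (bigD1 (Ordinal an)) // (bigD1 (Ordinal bn)) /=; last first.
  by apply/eqP => /(congr1 val) /= /esym.
rewrite [in RHS](bigD1 (Ordinal an)) // [in RHS](bigD1 (Ordinal bn)) /=; last first.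
  by apply/eqP => /(congr1 val) /= /esym.
rewrite !E la (negbTE lb) /move_letter !eqxx ifN_eq; last by apply/eqP => /esym.
rewrite (eq_bigr (fun x : 'I_n => (low p x * x)%N)); first by lia.
move=> x /andP [xa xb]; rewrite E /move_letter !ifN_eq //.
Qed.

Lemma area_bound p : area p <= (n * n)%N.
Proof.
rewrite /area -[X in (X * n)%N]card_ord -sum_nat_const; apply: leq_sum => x _.
by case: (low p x) => //; have := ltn_ord x; lia.
Qed.

Lemma hook_braid i j : i.+1 < n -> j.+1 < n -> i = j.+1 \/ j = i.+1 ->
  theta (hook_proj n j) (hook_proj n i) = hook_proj n j.
Proof.
move=> hi hj ij; apply/esym/eqP/leF_hookP => //.
have E : partner (hook n j) j = j.+1 by rewrite TL_partner_hook // /cup_act eqxx.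
have E' : partner (hook n j) j.+1 = j by rewrite -{1}E (nc_inv (partner_TL _)).
have : partner (hook n j) i < n \/ partner (hook n j) i.+1 < n.
  by case: ij => ij; [left; rewrite ij E' | right; rewrite -ij E]; lia.
exact.
Qed.

(** The product of the two hooks absorbs the first one on the right because it still has
    the arc from [i] to [i.+1]; this is enough for projections to commute. *)
Lemma hook_commute i j : i.+1 < j -> commute (hook n i) (hook n j).
Proof.
move=> ij; case: (ltnP j.+1 n) => hj; last first.
  rewrite [hook n j]hook_out //.
  by rewrite /commute mul1g mulg1.
have hi : i.+1 < n by lia.
apply: (@proj_commute _ (hook_proj n i) (hook_proj n j)).
apply: mul_hook_fix => //; rewrite TL_partner_mul_hook //.
have Ei : partner (hook n i) i = i.+1 by rewrite TL_partner_hook // /cup_act eqxx.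
by rewrite /cup_act [partner _ i]Ei !ifN_eq //; apply/eqP; lia.
Qed.

Definition apart i j := i.+1 < j \/ j.+1 < i.

Lemma hook_proj_commute i j : apart i j ->
  commute (val (hook_proj n i)) (val (hook_proj n j)).
Proof. by case=> /hook_commute // /commute_sym. Qed.

Inductive generated : proj (TL n) -> Prop :=
| generated_hook i : generated (hook_proj n i)
| generated_act q i : generated q -> generated (q ▷ i).

(** The product of the [k] hooks at [0, 2, ..., 2k - 2], whose lower word is
    [(UD)^k U^(n - 2k)]. The empty product is written as a hook out of range. *)
Fixpoint cups (k : nat) : proj (TL n) :=
  if k is k'.+1 then cups k' ▷ k'.*2 else hook_proj n n.

Lemma low_cups k : k.*2 <= n -> low (cups k) =1 (fun x => odd x && (x < k.*2)).
Proof.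
elim: k => [|k IH] h x /=.
  rewrite ltn0 andbF /low; case: (ltnP x n) => //= xn.
  by rewrite -[RHS](closes1 xn) -(hook_out (leqnSn n)).
have {}IH := IH ltac:(lia).
have hk : k.*2.+1 < n by lia.
have [K L E O I] := partner_TL (val (cups k)).
have def y : k.*2 <= y -> y < n -> n <= partner (val (cups k)) y.
  move=> yk yn; case: ltnP => // h2; have := IH y; have := IH (partner (val (cups k)) y).
  by rewrite !lowE // K; have := E y ltac:(lia); lia.
have [d0 d1] := (def k.*2 ltac:(lia) ltac:(lia), def k.*2.+1 ltac:(lia) ltac:(lia)).
move: x; apply: low_actE => // x xn; last by lia.
case: (cup_act _ _ _) / (cup_actP k.*2 x K) => [->|->|x0 x1 e|x0 x1 e|x0 x1 e e']; try lia.
by rewrite -lowE // IH; lia.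
Qed.

(** If UUD occurs in the word at [(i, i.+1, i.+2)], the projection is obtained by a
    raising move at [i.+1] from the projection [q ▷ i] of smaller area. If UUD does not
    occur, every closing letter belongs to an initial segment [(UD)^k]. *)
Lemma generated_proj q : generated q.
Proof.
have [k] := ubnP (area q); elim: k q => // k IH q /ltnSE ak.
have red i : i.+2 < n -> ~~ low q i -> ~~ low q i.+1 -> low q i.+2 -> generated q.
  move=> h l0 l1 l2; have hc : q ▷ i.+1 = q := move_cup l1 l2.
  have d : leF q (hook_proj n i).
    apply/leF_hookP; first by lia.
    by right; rewrite (cup_partner l1 l2).
  have [c [c1 c2 c3 c4]] := move_openings (ltnW h) l0 l1 d.
  have a1 := area_move c4 c2 l1 (ltnW h).
  have -> : q = q ▷ i ▷ i.+1.
    by rewrite -{2}hc thetaJ hook_braid //; lia.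
  by apply: generated_act; apply: IH; lia.
suff C d k' : d = n - k'.*2 -> k'.*2 <= n ->
    (forall x, x < k'.*2 -> low q x = odd x) -> generated q.
  by apply: (C n 0) => //; rewrite subn0.
elim/ltn_ind: d k' => d IHd k' dE k'n wE.
case: (pselect (exists x, (k'.*2 <= x) && low q x)) => [ex|nex]; last first.
  suff -> : q = cups k' by elim: (k') => [|j IHj]; [apply: generated_hook | apply: generated_act].
  apply: low_ext => x; rewrite low_cups //; case: (ltnP x k'.*2) => h; first by rewrite wE // andbT.
  by rewrite andbF; apply/negP => l; apply: nex; exists x; rewrite h.
case: (ex_minnP ex) => x /andP [xk lx] xmin.
have xn : x < n by move: lx; case: ltnP => // /low_out ->.
have nl y : k'.*2 <= y -> y < x -> ~~ low q y.
  by move=> h1 h2; apply/negP => l; have := xmin y; rewrite h1 l; lia.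
(* Here [x] is the first closing letter after the initial segment, which ends just
   before [k'.*2]. *)
have [c|c] := leqP k'.*2.+2 x.
  case: x xk lx xmin xn nl c => [|[|x]] // xk lx xmin xn nl c.
  by apply: (red x) => //; apply: nl; lia.
have [c'|c'] := leqP x k'.*2.
  (* All positions before [k'.*2] are matched among themselves, so a closing letter
     there would have no partner. *)
  have e : x = k'.*2 by lia.
  move: lx; rewrite lowE // => lx; have [K L E O I] := partner_TL (val q).
  set y := partner _ x in lx; have Ky : partner (val q) y = x by rewrite /y K.
  case oy : (odd y).
    have ye : y = y.-1.+1 by lia.
    have := @cup_partner q y.-1; rewrite -ye !wE; try lia.
    by rewrite oy => /(_ ltac:(lia) isT) h; have := K y.-1; rewrite h Ky; lia.
  by have := @cup_partner q y; rewrite !wE; try lia; rewrite /= oy Ky; lia.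
apply: (IHd (n - k'.+1.*2) _ k'.+1) => //; try lia.
move=> y; case: (ltngtP y k'.*2.+1) => h h2; try lia.
  have [h3|h3] := ltnP y k'.*2; first exact: wE.
  by rewrite (negbTE (nl y _ _)); lia.
have -> : y = x by lia.
by rewrite lx; lia.
Qed.

End Moves.

(** * Parallel paths are congruent *)

Section Coherence.
Variable n : nat.
Implicit Types (p q r : proj (TL n)) (i j x : nat).

Notation "p ▷ i" := (theta (hook_proj n i) p) (at level 50, left associativity).

Definition raised p : Prop := forall i, i.+1 < n -> low p i -> low p i.+1.

(** Only the maximal raising paths, ending where no move DU -> UD applies. *)
Inductive raising : proj (TL n) -> seq (proj (TL n)) -> Prop :=
| raising_stop p : raised p -> raising p [:: p]
| raising_step p i s : i.+1 < n -> low p i -> ~~ low p i.+1 -> raising (p ▷ i) s ->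
    raising p (p :: s).

Lemma raising_head p s : raising p s -> exists s', s = p :: s'.
Proof. by case=> [{}p _|{}p i {}s _ _ _ _]; [exists [::] | exists s]. Qed.

Lemma raising_path p s : raising p s -> is_ppath s.
Proof.
elim=> {p s} [//|p i s h l0 l1 rs IH].
have [s' E] := raising_head rs; rewrite E in IH *; rewrite ppath_cons IH andbT.
by apply: relF_theta; have [] := move_raise h l0 l1.
Qed.

Lemma area_raise p i : i.+1 < n -> low p i -> ~~ low p i.+1 -> area (p ▷ i) = (area p).+1.
Proof.
move=> h l0 l1; have [_ E] := move_raise h l0 l1.
by have := area_move E l0 l1 h; lia.
Qed.

Definition gap p := n * n - area p.

Lemma gap_raise p i : i.+1 < n -> low p i -> ~~ low p i.+1 -> gap (p ▷ i) < gap p.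
Proof.
move=> h l0 l1; have := area_raise h l0 l1; have := area_bound (p ▷ i).
by rewrite /gap; lia.
Qed.

Lemma raising_exists p : exists s, raising p s.
Proof.
have [k] := ubnP (gap p); elim: k p => // k IH p /ltnSE ak.
case: (pselect (raised p)) => [|nr]; first by exists [:: p]; apply: raising_stop.
have [i [h l0 l1]] : exists i, [/\ i.+1 < n, low p i & ~~ low p i.+1].
  apply: contrapT => ne; apply: nr => i h l0; apply: contrapT => l1.
  by apply: ne; exists i; split=> //; apply/negP.
have [s rs] := IH (p ▷ i) (leq_trans (gap_raise h l0 l1) ak).
by exists (p :: s); apply: raising_step rs.
Qed.

Lemma raise_other p i j : i.+1 < n -> j.+1 < n -> i <> j ->
  low p i -> ~~ low p i.+1 -> low p j -> ~~ low p j.+1 ->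
  low (p ▷ i) j /\ ~~ low (p ▷ i) j.+1.
Proof.
move=> hi hj ij l0 l1 k0 k1; have [_ E] := move_raise hi l0 l1.
rewrite !E /move_letter.
have n1 : j <> i.+1 by move=> e; rewrite e (negbTE l1) in k0.
have n2 : j.+1 <> i by move=> e; rewrite e l0 in k1.
by rewrite !ifN_eq; first split=> //; apply/eqP; lia.
Qed.

Lemma apart_sym i j : apart i j -> apart j i.
Proof. by case; [right | left]. Qed.

Lemma act_commute p i j : apart i j -> p ▷ i ▷ j = p ▷ j ▷ i.
Proof.
move=> ij.
by have [_ e _] := @commute_theta (TL n) (hook_proj n i) (hook_proj n j) p (hook_proj_commute n ij).
Qed.

(** If the path through [p ▷ i] exists then so do the other path around the square and
    the diagonal, since all three say that [p] lies below the product of the two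
    hooks in the sense of [leF]. *)
Lemma cong_act_commute p i j : apart i j ->
  leF p (hook_proj n i) -> leF (p ▷ i) (hook_proj n j) ->
  [/\ leF p (hook_proj n j), leF (p ▷ j) (hook_proj n i), relF p (p ▷ i ▷ j),
    pg_cong [:: p; p ▷ i; p ▷ i ▷ j] [:: p; p ▷ i ▷ j] &
    pg_cong [:: p; p ▷ j; p ▷ i ▷ j] [:: p; p ▷ i ▷ j]].
Proof.
move=> ij d1 d2; have d3 := leF_theta_comp d1 d2.
move: (hook_proj n i) (hook_proj n j) (hook_proj_commute n ij) d1 d2 d3 => s t st d1 d2 d3.
have [e1 e2 e3] := @commute_theta (TL n) s t p st.
have [e1' e2' e3'] := @commute_theta (TL n) t s p (commute_sym st).
have e : theta s t = theta t s by apply: val_inj; rewrite e1 e1'; apply: st.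
(* The hypothesis [d3] says that [p] lies below the product of the two hooks, which is
   symmetric in them. *)
have d4 := d3; rewrite e in d4; have [d5 d6 _] := leF_theta d4.
split.
- exact: d5.
- exact: d6.
- rewrite e3; exact: (relF_theta d3).
- exact: (cong_commute d3 e2 e3).
- rewrite e2; exact: (cong_commute d4 e2' e3').
Qed.

(** Newman's lemma: two raising moves at different places are far apart, so they
    commute and are completed to a square that splits into two triangles. *)
Lemma raising_unique p s s' : raising p s -> raising p s' -> pg_cong s s'.
Proof.
have [k] := ubnP (gap p); elim: k p s s' => // k IH p s s' /ltnSE ak rs.
case: rs ak => {p s} [p rp|p i s hi l0 l1 rs] ak rs'.
  case: rs' rp {ak} => {p s'} [p _ _|p i s hi l0 l1 _ rp]; first exact: pg_refl.
  by rewrite rp in l1.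
move: (raising_path rs') => ps'.
case: rs' ak l0 l1 rs ps' => {p s'} [p rp|p j s' hj k0 k1 rs'] ak l0 l1 rs ps'.
  by rewrite rp in l1.
have [d1 _] := move_raise hi l0 l1; have [d2 _] := move_raise hj k0 k1.
have [t E] := raising_head rs; have [t' E'] := raising_head rs'; subst s s'.
have [ij|/eqP ij] := eqVneq i j.
  subst j; apply: cong_cons; first exact: relF_theta.
  exact: IH (leq_trans (gap_raise hi l0 l1) ak) rs rs'.
have key i' j' u u' : apart i' j' -> i'.+1 < n -> j'.+1 < n -> low p i' -> ~~ low p i'.+1 ->
   low p j' -> ~~ low p j'.+1 -> raising (p ▷ i') (p ▷ i' :: u) ->
   raising (p ▷ j') (p ▷ j' :: u') -> pg_cong (p :: p ▷ i' :: u) (p :: p ▷ j' :: u').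
  move=> {hi l0 l1 hj k0 k1 rs rs' d1 d2 ij ps'} ij hi hj l0 l1 k0 k1 rs rs'.
  have [d1 _] := move_raise hi l0 l1; have [d2 _] := move_raise hj k0 k1.
  have ne : i' <> j' by move: ij; rewrite /apart; lia.
  have [m0 m1] := raise_other hi hj ne l0 l1 k0 k1.
  have [m2 m3] := raise_other hj hi (nesym ne) k0 k1 l0 l1.
  have [d3 _] := move_raise hj m0 m1.
  have [_ _ _ c1 c2] := cong_act_commute ij d1 d3.
  have [t3 rt] := raising_exists (p ▷ i' ▷ j').
  have rt' := rt; rewrite act_commute // in rt'.
  have r1 := raising_step hj m0 m1 rt; have r2 := raising_step hi m2 m3 rt'.
  have g1 := IH _ _ _ (leq_trans (gap_raise hi l0 l1) ak) rs r1.
  have g2 := IH _ _ _ (leq_trans (gap_raise hj k0 k1) ak) rs' r2.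
  have [t4 E] := raising_head rt; subst t3.
  have p3 := raising_path rt.
  apply: pg_trans (cong_cons (relF_theta d1) g1) _.
  apply: pg_sym; apply: pg_trans (cong_cons (relF_theta d2) g2) _; apply: pg_sym.
  have h1 := cong_catr (s := [:: p; p ▷ i']) (s' := [:: p]) c1 p3.
  have h2 := cong_catr (s := [:: p; p ▷ j']) (s' := [:: p]) c2 p3.
  exact: pg_trans h1 (pg_sym h2).
(* Two different occurrences of DU do not overlap. *)
have n1 : j <> i.+1 by move=> e; rewrite e (negbTE l1) in k0.
have n2 : i <> j.+1 by move=> e; rewrite e (negbTE k1) in l0.
by apply: key rs rs' => //; rewrite /apart; lia.
Qed.

(** The edge [(p, q)] is compatible with the contraction along raising paths. *)
Definition coherent p q : Prop := relF p q /\
  forall s t, raising p s -> raising q t -> pg_cong (p :: t) s.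

Lemma coherent_refl p : coherent p p.
Proof.
split=> [|s t rs rt]; first exact: relFxx.
have [t' E] := raising_head rt; subst t.
apply: pg_trans (cong_dup (raising_path rt)) _; exact: raising_unique rt rs.
Qed.

Lemma coherent_sym p q : coherent p q -> coherent q p.
Proof.
move=> [pq c]; split=> [|s t rs rt]; first by rewrite relF_sym.
have qp : relF q p by rewrite relF_sym.
have [s' E] := raising_head rs; have [t' E'] := raising_head rt; subst s t.
apply: pg_trans (cong_cons qp (pg_sym (c _ _ rt rs))) _.
exact: cong_back (raising_path rs).
Qed.

Fixpoint coherent_path p (u : seq (proj (TL n))) : Prop :=
  if u is q :: u' then coherent p q /\ coherent_path q u' else True.

Lemma coherent_pathP p u s t : coherent_path p u -> raising p s -> raising (last p u) t ->
  pg_cong (belast p u ++ t) s.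
Proof.
elim: u p s => [|q u IH] p s /=; first by move=> _ rs rt; exact: raising_unique rt rs.
move=> [[pq c] cu] rs rt; have [s' rs'] := raising_exists q.
apply: pg_trans (c _ _ rs rs').
have {}IH := IH _ _ cu rs' rt; have [s1 E] := raising_head rs'; subst s'.
apply: (@pg_cong_join _ [:: p] [:: p] _ _ p (pg_refl _) IH); first by [].
by rewrite (pg_cong_head p IH).
Qed.

Lemma coherent_trans p u r : coherent_path p (rcons u r) -> relF p r ->
  pg_cong (p :: rcons u r) [:: p; r] -> coherent p r.
Proof.
move=> c pr e; split=> [|s t rs rt]; first exact: pr.
have := coherent_pathP c rs; rewrite last_rcons belast_rcons => /(_ _ rt).
apply: pg_trans; have [t' E'] := raising_head rt; subst t.
have := cong_catr (s := [:: p]) (s' := p :: u) (pg_sym e) (raising_path rt).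
by rewrite -!cats1 -!catA.
Qed.

Lemma coherent_raise p i : i.+1 < n -> low p i -> ~~ low p i.+1 -> coherent p (p ▷ i).
Proof.
move=> h l0 l1; have [d _] := move_raise h l0 l1.
split=> [|s t rs rt]; first exact: relF_theta.
by apply: raising_unique rs; apply: raising_step rt.
Qed.

(** Coherence of three sides of a commuting square gives coherence of the fourth. The
    hypotheses on the two sides through [p ▷ i] are conditional because the relation
    [leF] that makes them edges is a consequence of the others. *)
Lemma coherent_square p i j : apart i j ->
  leF p (hook_proj n j) -> leF (p ▷ j) (hook_proj n i) -> coherent p (p ▷ j) ->
  (leF p (hook_proj n i) -> coherent p (p ▷ i)) ->
  (leF p (hook_proj n i) -> leF (p ▷ i) (hook_proj n j) ->
   coherent (p ▷ i) (p ▷ i ▷ j)) ->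
  coherent (p ▷ j) (p ▷ j ▷ i).
Proof.
move=> ij d1 d2 c c1 c2.
have [d3 d4 r h1 h2] := cong_act_commute (apart_sym ij) d1 d2.
have e := act_commute p ij.
have {}c1 := c1 d3; have := c2 d3 d4; rewrite e => {}c2.
have c3 := coherent_trans (u := [:: _]) (conj c1 (conj c2 I)) r h2.
apply: (coherent_trans (u := [:: _]) (conj (coherent_sym c) (conj c3 I)) (relF_theta d2)).
have [pj _] := c.
have := cong_cons (p := p ▷ j) _ h1; rewrite relF_sym => /(_ pj) /pg_sym h3.
apply: pg_trans h3 _; apply: (cong_back (s := [:: _])); first by rewrite relF_sym.
by rewrite ppath_cons (relF_theta d2).
Qed.

(** The relation [t_j t_i t_j = t_j] for adjacent hooks, applied to a projection
    below [t_j]. *)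
Lemma act_braid p i j : i.+1 < n -> j.+1 < n -> i = j.+1 \/ j = i.+1 ->
  p ▷ j = p -> p ▷ i ▷ j = p.
Proof. by move=> hi hj ij e; rewrite -{1}e thetaJ hook_braid. Qed.

Lemma area_decr p q a b : low q =1 move_letter (low p) a b ->
  low p a -> ~~ low p b -> b < a -> area q < area p.
Proof.
move=> E la lb ba; have an : a < n by move: la; case: ltnP => // /low_out ->.
have := area_move E la lb (ltn_trans ba an); move: (area q) (area p) => x y; clear -ba; lia.
Qed.

(** Let [x] be the first closing letter after [i]. If [x = i.+2], the edge is the inverse
    of a raising edge. Otherwise UUD occurs at [(x - 2, x - 1, x)], and lowering it to
    UDU gives a projection of smaller area from which [p] is obtained by raising at
    [x - 1]; as [x - 1] is far apart from [i], the edge is a side of a commuting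
    square. *)
Lemma coherent_act_openings p i : i.+1 < n -> ~~ low p i -> ~~ low p i.+1 ->
  leF p (hook_proj n i) ->
  (forall q j, area q < area p -> leF q (hook_proj n j) -> coherent q (q ▷ j)) ->
  coherent p (p ▷ i).
Proof.
move=> h l0 l1 d IH; have [c [c1 c2 c3 c4]] := move_openings h l0 l1 d.
have lt_n x : low p x -> x < n by case: (ltnP x n) => // /low_out ->.
have ex : exists x, (i.+1 < x) && low p x by exists c; rewrite c1.
have [x /andP [x1 x2] xmin] := ex_minnP ex.
have lo y : i <= y -> y < x -> ~~ low p y.
  move=> iy yx; apply/negP => ly; have := xmin y; rewrite ly andbT.
  have ne0 : y <> i by move=> e; rewrite e (negbTE l0) in ly.
  have ne1 : y <> i.+1 by move=> e; rewrite e (negbTE l1) in ly.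
  by lia.
have xn := lt_n x x2.
have [e|ne] := eqVneq x i.+2.
  rewrite e in x2 xn; have e' : p ▷ i ▷ i.+1 = p.
    by apply: act_braid (move_cup l1 x2) => //; right.
  have ce := c3 x2; rewrite ce in c4.
  have := coherent_raise (p := p ▷ i) xn; rewrite !c4 e' /move_letter !eqxx.
  rewrite ifN_eq; last by apply/eqP; lia.
  by move=> /(_ isT isT); apply: coherent_sym.
have [j ej] : exists j, x = j.+2 by exists x.-2; clear -x1; lia.
subst x; have ij : i < j by clear -x1 ne; lia.
have j1 := lo j (ltnW ij) ltac:(clear; lia).
have j2 := lo j.+1 ltac:(clear -ij; lia) (ltnSn _).
have hj : j.+1 < n := ltnW xn.
have dj : leF p (hook_proj n j).
  by apply/leF_hookP; [exact: hj | right; rewrite (cup_partner j2 x2)].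
have [a [a1 a2 a3 a4]] := move_openings hj j1 j2 dj.
have ea := a3 x2; rewrite ea in a1 a2 a4.
have e : p ▷ j ▷ j.+1 = p by apply: (act_braid hj xn _ (move_cup j2 x2)); right.
have m0 : low (p ▷ j) j.+1.
  by rewrite a4 /move_letter eqxx ifN_eq //; clear; apply/eqP; lia.
have m1 : ~~ low (p ▷ j) j.+2 by rewrite a4 /move_letter eqxx.
have u0 : ~~ low (p ▷ j) i.
  by rewrite a4 /move_letter !ifN_eq //; clear -ij; apply/eqP; lia.
have u1 : ~~ low (p ▷ j) i.+1.
  by rewrite a4 /move_letter !ifN_eq //; clear -ij; apply/eqP; lia.
have ap : apart i j.+1 by left.
have [dr _] := move_raise xn m0 m1.
have d' : leF (p ▷ j ▷ j.+1) (hook_proj n i).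
  by rewrite e; exact: d.
have lt1 : area (p ▷ j) < area p := area_decr a4 a2 j2 (ltnSn _).
rewrite -[in X in coherent X _]e -[in X in coherent _ (X ▷ _)]e.
(* The square at [p ▷ j], with sides given by the hooks [j.+1] and [i]. *)
apply: (coherent_square ap dr d' (coherent_raise xn m0 m1)).
  exact: IH lt1.
move=> d2; apply: IH.
have [b [b1 b2 _ b4]] := move_openings h u0 u1 d2.
exact: ltn_trans (area_decr b4 b2 u1 b1) lt1.
Qed.

(** The mirror image of the previous argument: let [j] be the last opening letter before
    [i]. Either [i = j.+1] and the edge is the inverse of a raising edge, or UDD occurs
    at [(j, j.+1, j.+2)] and is lowered to DUD. *)
Lemma coherent_act_closings p i : i.+1 < n -> low p i -> low p i.+1 ->
  (forall q j, area q < area p -> leF q (hook_proj n j) -> coherent q (q ▷ j)) ->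
  coherent p (p ▷ i).
Proof.
move=> h l0 l1 IH; have [d [c [c1 c2 c3 c4]]] := move_closings h l0 l1.
have ex : exists x, (x < i) && ~~ low p x by exists c; rewrite c1.
have bd x : (x < i) && ~~ low p x -> x <= i by case/andP => /ltnW.
have [j /andP [ji j1] jmax] := ex_maxnP ex bd.
have up y : j < y -> y <= i -> low p y.
  move=> jy; rewrite leq_eqVlt => /orP [/eqP -> //|yi]; apply/negPn/negP => ly.
  by have := jmax y; rewrite yi ly => /(_ isT); rewrite leqNgt jy.
have [e|ne] := eqVneq i j.+1.
  subst i; have hj : j.+1 < n := ltnW h.
  have e' : p ▷ j.+1 ▷ j = p by apply: (act_braid h hj _ (move_cup j1 l0)); left.
  have ce := c3 j1; rewrite /= in ce; subst c.
  have m0 : low (p ▷ j.+1) j.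
    by rewrite c4 /move_letter eqxx ifN_eq //; clear; apply/eqP; lia.
  have m1 : ~~ low (p ▷ j.+1) j.+1 by rewrite c4 /move_letter eqxx.
  by have := coherent_raise hj m0 m1; rewrite e'; apply: coherent_sym.
have ij : j.+1 < i by clear -ji ne; lia.
have j2 := up j.+1 (ltnSn _) (ltnW ij); have j3 := up j.+2 ltac:(clear; lia) ij.
have hj : j.+2 < n := leq_ltn_trans ij (ltnW h).
have hj' : j.+1 < n := ltnW hj.
have [dj [a [a1 a2 a3 a4]]] := move_closings hj j2 j3.
have ea := a3 j1; rewrite /= in ea; subst a.
have e : p ▷ j.+1 ▷ j = p by apply: (act_braid hj hj' _ (move_cup j1 j2)); left.
have m0 : low (p ▷ j.+1) j.
  by rewrite a4 /move_letter eqxx ifN_eq //; clear; apply/eqP; lia.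
have m1 : ~~ low (p ▷ j.+1) j.+1 by rewrite a4 /move_letter eqxx.
have u0 : low (p ▷ j.+1) i.
  by rewrite a4 /move_letter !ifN_eq //; clear -ij; apply/eqP; lia.
have u1 : low (p ▷ j.+1) i.+1.
  by rewrite a4 /move_letter !ifN_eq //; clear -ij; apply/eqP; lia.
have ap : apart i j by right.
have [dr _] := move_raise hj' m0 m1.
have d' : leF (p ▷ j.+1 ▷ j) (hook_proj n i).
  by rewrite e; exact: d.
have lt1 : area (p ▷ j.+1) < area p := area_decr a4 j2 j1 (ltnSn _).
rewrite -[in X in coherent X _]e -[in X in coherent _ (X ▷ _)]e.
(* The square at [p ▷ j.+1], with sides given by the hooks [j] and [i]. *)
apply: (coherent_square ap dr d' (coherent_raise hj' m0 m1)).
  exact: IH lt1.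
move=> d2; apply: IH.
have [_ [b [b1 b2 _ b4]]] := move_closings h u0 u1.
exact: ltn_trans (area_decr b4 u0 b2 b1) lt1.
Qed.

Lemma act_out p i : n <= i.+1 -> p ▷ i = p.
Proof.
move=> h; apply: val_inj; rewrite val_theta.
by rewrite (hook_out h : val (hook_proj n i) = 1%g) mul1g mulg1.
Qed.

Lemma coherent_act p i : leF p (hook_proj n i) -> coherent p (p ▷ i).
Proof.
have [k] := ubnP (area p); elim: k p i => // k IHk p i /ltnSE ak d.
have {}IHk q j : area q < area p -> leF q (hook_proj n j) -> coherent q (q ▷ j).
  by move=> lt; apply: IHk; apply: leq_trans ak.
case: (ltnP i.+1 n) => h; last by rewrite act_out; [apply: coherent_refl | exact: h].
case: (boolP (low p i)) => l0; case: (boolP (low p i.+1)) => l1.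
- exact: coherent_act_closings.
- exact: coherent_raise.
- rewrite move_cup; [exact: coherent_refl | exact: l0 | exact: l1].
- exact: coherent_act_openings.
Qed.

Lemma coherent_generated q p : generated q -> leF p q -> coherent p (theta q p).
Proof.
move=> gq; elim: gq p => {q} [i|q i _ IH] p d; first exact: coherent_act.
have [d1 d2 d3] := leF_theta d.
have c1 := coherent_act d1; have c2 := IH _ d2; have c3 := coherent_act d3.
have e : theta (theta (hook_proj n i) q) p = theta q (p ▷ i) ▷ i by rewrite -thetaJ.
have cc := cong_conj d d1 d2 d3; rewrite e in cc *.
have r : relF p (theta q (p ▷ i) ▷ i) by rewrite -e; exact: (relF_theta d).
exact: (coherent_trans (u := [:: _; _]) (conj c1 (conj c2 (conj c3 I))) r cc).
Qed.

Lemma coherent_relF p q : relF p q -> coherent p q.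
Proof.
move=> pq; have [_ <-] := relFP _ _ pq.
by apply: coherent_generated (generated_proj q) _; case/andP: pq.
Qed.

Lemma coherent_ppath p u : is_ppath (p :: u) -> coherent_path p u.
Proof.
elim: u p => [|q u IH] p //=; rewrite ppath_cons => /andP [/coherent_relF c /IH]; exact: conj.
Qed.

(** Both paths are congruent to a raising path from the common start followed by the
    reverse of a raising path from the common end. *)
Lemma cong_parallel p u v : is_ppath (p :: u) -> is_ppath (p :: v) -> last p u = last p v ->
  pg_cong (p :: u) (p :: v).
Proof.
have [s rs] := raising_exists p; have [t rt] := raising_exists (last p u).
have key w : is_ppath (p :: w) -> last p w = last p u -> pg_cong (p :: w) (s ++ rev t).
  move=> pw e; rewrite -e in rt; have pt := raising_path rt.
  have c := coherent_pathP (coherent_ppath pw) rs rt.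
  have [t' E] := raising_head rt; subst t.
  have r : relF (last p (belast p w ++ last p w :: t')) (head p (rev (last p w :: t'))).
    by rewrite last_cat /= -nth0 nth_rev //= subn1 nth_last /= relFxx.
  have ptr : is_ppath (rev (last p w :: t')) by rewrite is_ppath_rev.
  apply: pg_trans (pg_cong_join c (pg_refl ptr) r).
  have pw' := pw; rewrite lastI in pw'; rewrite lastI -cat_rcons -catA.
  have h := pg_comp (pg_refl pw') (cong_loop pt).
  by apply: pg_sym; rewrite cats0 in h; exact: h.
by move=> pu pv e; apply: pg_trans (key _ pu erefl) (pg_sym (key _ pv (esym e))).
Qed.

End Coherence.

(** * The isomorphism *)

(** The words that cannot be raised are those of the form [U ... U D ... D], so they are
    determined by the number of letters D. *)
Lemma monotone_count_sub (n : nat) (w w' : nat -> bool) :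
  (forall i, i.+1 < n -> w i -> w i.+1) -> (forall i, i.+1 < n -> w' i -> w' i.+1) ->
  \sum_(x < n) w x <= \sum_(x < n) w' x -> forall x, x < n -> w x -> w' x.
Proof.
move=> m m' le x xn wx; apply/negPn/negP => w'x.
have mono (v : nat -> bool) : (forall i, i.+1 < n -> v i -> v i.+1) ->
    forall y z, y <= z -> z < n -> v y -> v z.
  move=> mv y z /subnKC <-; elim: (z - y) => [|d IH]; first by rewrite addn0.
  rewrite addnS => h vy; apply: mv => //; apply: IH => //; exact: ltnW.
have sub (y : 'I_n) : w' y <= w y.
  case w'y : (w' y) => //; case: (leqP y x) => yx.
    by move: w'x; rewrite (mono _ m' _ _ yx xn w'y).
  by rewrite (mono _ m _ _ (ltnW yx) (ltn_ord y) wx).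
move: le; rewrite leqNgt => /negP; apply.
rewrite (bigD1 (Ordinal xn)) //= [X in _ < X](bigD1 (Ordinal xn)) //= wx (negbTE w'x).
by rewrite add0n add1n ltnS leq_sum.
Qed.

Section Range.
Variable n : nat.
Implicit Types (a b : TL n) (p q : proj (TL n)) (i x : nat).
Local Open Scope group_scope.

Lemma low_right_proj a x : low (right_proj a) x = (x < n) && closes a x.
Proof. by rewrite /low; case: (ltnP x n) => //= xn; apply: closes_mul_star. Qed.

Definition is_path_prod a : Prop := exists2 u, is_ppath u & path_prod u = a.

Lemma is_path_prod_proj p : is_path_prod (val p).
Proof. by exists [:: p] => //; rewrite path_prod_cons path_prod_nil mulg1. Qed.

Lemma is_path_prod_mul a b : is_path_prod a -> is_path_prod b -> is_path_prod (a * b).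
Proof.
move=> [u pu <-] [v pv <-]; exists (path_mul u v); first exact: path_mul_path.
by apply: path_prod_mul; [case/andP: pu | case/andP: pv].
Qed.

Lemma is_path_prod_star a : is_path_prod a -> is_path_prod (star a).
Proof. by move=> [u pu <-]; exists (rev u); rewrite ?is_ppath_rev ?path_prod_rev. Qed.

(** If [q] does not lower the rank of [a], then [a] is recovered from [a q] by multiplying
    with its right projection. *)
Lemma is_path_prod_raise a q : leF (right_proj a) q ->
  is_path_prod (a * val q) -> is_path_prod a.
Proof.
move=> d r; rewrite -(mul_leF_right_proj d).
exact: is_path_prod_mul r (is_path_prod_proj _).
Qed.

(** The two rows of [a] have the same word: both words are increasing and they have the
    same number of closing letters. *)
Lemma raised_right_proj a : raised (right_proj a) -> raised (right_proj (star a)) ->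
  a = val (right_proj a).
Proof.
move=> r r'.
have S : \sum_(x < n) closes a x = \sum_(x < n) closes (star a) x.
  exact: count_closes (TL_tl a).
have m b : raised (right_proj b) -> forall i, i.+1 < n -> closes b i -> closes b i.+1.
  move=> rb i h; have := rb i h; rewrite !low_right_proj h; rewrite (ltnW h); exact.
have E x : x < n -> closes a x = closes (star a) x.
  move=> xn; apply/idP/idP; apply: monotone_count_sub xn; try exact: m; by rewrite S.
have Eq x : x < n -> closes (val (right_proj a)) x = closes a x by apply: closes_mul_star.
apply: val_inj; apply: (closes_tl_ext (TL_tl _) (TL_tl _)) => x xn; first by rewrite [RHS]Eq.
rewrite -![ptn_star _]/(tl_val (star _)) proj_star [RHS]Eq //; exact/esym/E.
Qed.

(** Raise the lower row and the upper row of [a] until neither can be raised. *)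
Lemma is_path_prodP a : is_path_prod a.
Proof.
have [k] := ubnP (gap (right_proj a) + gap (right_proj (star a)))%N.
elim: k a => // k IH a /ltnSE ak.
have step b i : i.+1 < n -> low (right_proj b) i -> ~~ low (right_proj b) i.+1 ->
    (gap (right_proj b) + gap (right_proj (star b)) <= k)%N -> is_path_prod b.
  move=> h l0 l1 bk; have [d _] := move_raise h l0 l1.
  apply: is_path_prod_raise d _; apply: IH; apply: leq_trans bk; rewrite right_proj_mul.
  suff -> : right_proj (star (b * val (hook_proj n i))) = right_proj (star b).
    by rewrite ltn_add2r; apply: gap_raise.
  apply: low_ext => x; rewrite !low_right_proj; case: (ltnP x n) => //= xn.
  apply: closes_star_mul_hook => //; left.
  by move: l0; rewrite low_right_proj => /andP [li]; rewrite /closes => h1; apply: ltn_trans h1 li.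
have dec b : raised (right_proj b) \/
    (exists i, [/\ i.+1 < n, low (right_proj b) i & ~~ low (right_proj b) i.+1]).
  case: (pselect (raised (right_proj b))) => [|nr]; [by left | right].
  apply: contrapT => ne; apply: nr => i h l0; apply: contrapT => l1.
  by apply: ne; exists i; split=> //; apply/negP.
case: (dec a) => [r|[i [h l0 l1]]]; last exact: step h l0 l1 ak.
case: (dec (star a)) => [r'|[i [h l0 l1]]].
  by rewrite (raised_right_proj r r'); apply: is_path_prod_proj.
rewrite -[a]starK; apply: is_path_prod_star; apply: step h l0 l1 _.
by rewrite starK addnC.
Qed.

End Range.

Section Isomorphism.
Variable n : nat.
Notation P := (proj (TL n)).

Definition pg_eval (u : PG P) : TL n := path_prod (ppath_val (repr u)).

Lemma pg_eval_pi (w : ppath P) : pg_eval (\pi_(PG P) w) = path_prod (ppath_val w).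
Proof.
apply/esym/path_prod_cong/asboolP.
rewrite -[asbool _]/(pg_equiv P w (repr (\pi_(PG P) w))).
by apply/eqmodP; rewrite reprK.
Qed.

Lemma pg_eval_mul : {morph pg_eval : u v / (u * v)%g >-> (u * v)%g}.
Proof.
move=> u v; rewrite -[u]reprK -[v]reprK -[(_ * _)%g]/(pg_mul _ _) -pi_pg_mul !pg_eval_pi.
by apply: path_prod_mul; [case/andP: (valP (repr u)) | case/andP: (valP (repr v))].
Qed.

Lemma pg_eval_inj : injective pg_eval.
Proof.
move=> u v; rewrite -[u]reprK -[v]reprK !pg_eval_pi => E.
apply/eqmodP/asboolP.
case: (repr u) (repr v) E => [[|p s] // ps] [[|q t] // qt] /= E.
have pq : p = q by apply: val_inj; rewrite -(path_prod_star ps) E path_prod_star.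
subst q; apply: cong_parallel => //.
apply: val_inj.
have := @star_path_prod n (last p s) (belast p s); rewrite -lastI => <- //.
by have := @star_path_prod n (last p t) (belast p t); rewrite -lastI E => <-.
Qed.

Lemma pg_eval_surj (a : TL n) : exists u, pg_eval u == a.
Proof.
have [s ps <-] := is_path_prodP a.
by exists (\pi_(PG P) (PPath ps)); rewrite pg_eval_pi.
Qed.

End Isomorphism.

HB.instance Definition _ n :=
  isMultiplicative.Build (PG (proj (TL n))) (TL n) (@pg_eval n) (@pg_eval_mul n).

Theorem theorem9p1 (n : nat) (hn : 1 <= n) :
  exists f : {multiplicative PG (proj (TL n)) -> TL n}, bijective f.
Proof.
exists (@pg_eval n).
exists (fun a => xchoose (pg_eval_surj a)) => [u|a].
  by apply: pg_eval_inj; apply/eqP/(xchooseP (pg_eval_surj _)).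
by apply/eqP/(xchooseP (pg_eval_surj a)).
Qed.
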